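(* Consider dense random networks: for each $k\ge2$, the source node $1$ is at the corner $(0,0)$ of the square $[0,\sqrt{A_k}]^2$ of area $A_k$, and the $k-1$ non-source nodes are placed independently and uniformly over this square, where $A_k=o(k/\log k)$ and $r_0^2\le 8A_k$ for all $k\ge 2$. The destination set is $\{2,\dots,k\}$, and channel gains are given by the path loss model with constants $\alpha>2$, $r_0>0$, $\bar g>0$. Then, with probability $1$, the node placement is such that, for all but a finite number of $k$, $$c_1\le \frac1{A_k}\,\frac{{E_b}_{\min}}{N_0}\qquad\text{and}\qquad \frac1{A_k}\,\frac{{E_b}_{\rm flood}}{N_0}\le c_2,$$ where $$c_1=\frac{2\log_e2}{49\,\bar g\,r_0^2+\frac{2^{\alpha+2}}{\alpha-2}\,\frac{3}{r_0^{\alpha-2}}},\qquad c_2=24\,r_0^{\alpha-2}\log_e2 .$$ The second bound means: there is a sequence of flooding schemes whose parameters do not depend on the node placement (they may depend on $k$, $A_k$, $N_0$ and the path loss model) such that, with probability $1$, for all but finitely many $k$ every scheme of the sequence reliably delivers the message to all nodes and the infimum ${E_b}_{\rm flood}$ of their total energies per bit satisfies the stated inequality.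
   Context: Channel model. There are $k$ nodes. At discrete time $t$ node $i$ transmits $x_{i,t}\in\mathbb C$ and node $j$ receives $y_{j,t}=\sum_{i=1}^k h_{ij,t}x_{i,t}+z_{j,t}$. The noises $z_{j,t}$ are $\mathcal{CN}(0,N_0)$, independent over $j$ and $t$. The fading coefficients $h_{ij,t}$ ($i\ne j$) are circularly symmetric complex random variables, i.i.d. over time; $h_{ij,t}$ and $h_{lm,t}$ are independent for $(i,j)\neq(l,m)$; $h_{ii,t}=0$. Message, noise and fading are mutually independent. Channel state information is not available at the transmitters: $x_{i,t}$ is independent of $(h_{i1,t},\dots,h_{ik,t})$. Path loss model. Given the placement, $\mathbb E[|h_{ij}|^2]=g(r_{ij})$, with $r_{ij}$ the Euclidean distance between nodes $i$ and $j$, where $g:\mathbb R_+\to\mathbb R_+$ is monotonically decreasing, $g(r)=r^{-\alpha}$ for all $r\ge r_0$, and $g(0)\le\bar g$. Minimum energy per bit (for a fixed placement, destination set $\mathcal R=\{2,\dots,k\}$). A code of block length $n$ with $M$ equiprobable messages consists of a source codeword $x_1^{(n)}(m)\in\mathbb C^n$, causal relay functions $x_{i,t}=x_{i,t}(y_{i,1},\dots,y_{i,t-1})$ for $i\ge2$, and decoders $\hat m_i(y_{i,1},\dots,y_{i,n})$ for $i\in\mathcal R$; its error probability is the probability (averaged over messages) that some $i\in\mathcal R$ has $\hat m_i\ne m$; its expected total energy is $\mathbb E[\sum_i\sum_t|x_{i,t}|^2]$. An $(n,M,E_{\rm total},\epsilon)$ code has expected total energy at most $E_{\rm total}$ and error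 probability at most $\epsilon$. $E_b\ge0$ is $\epsilon$-achievable if for every $\delta>0$ there is $E_0$ such that for every $E_{\rm total}\ge E_0$ there is an $(n,M,E_{\rm total},\epsilon)$ code with $E_{\rm total}/\log_2M<E_b+\delta$; it is achievable if $\epsilon$-achievable for all $0<\epsilon<1$; ${E_b}_{\min}$ is the infimum of achievable values. Flooding. In $\mathtt{FLOOD}({E_b}_1,{E_b}_2)$ time is divided into slots $1,\dots,T$ ($T$ a design parameter). The source transmits only in slot $1$, with energy per bit ${E_b}_1$. In each slot $t=2,\dots,T$, a non-source node that was able to decode for the first time in slot $t-1$ retransmits the same message with energy per bit ${E_b}_2$; otherwise it is silent. Thus each node transmits at most once. There is no bandwidth constraint and nodes use mutually orthogonal wide frequency bands, so that a node accumulates received energy over all transmissions: its received energy per bit by the end of a slot is the sum, over the (correct) transmissions made so far by other nodes, of channel gain times transmitted energy per bit. A node is able to decode reliably (with vanishing error probability) by the end of a slot once its accumulated received energy per bit strictly exceeds $N_0\log_e2$. The total energy per bit ${E_b}_{\rm total}$ of the scheme is the sum of the energies per bit of all transmissions, so ${E_b}_{\rm total}\le {E_b}_1+(k-1){E_b}_2$. For a sequence of flooding schemes reaching all nodes, ${E_b}_{\rm flood}$ denotes the infimum of ${E_b}_{\rm total}$ over the sequence. The random placements for different $k$ live on a common probability space (no assumption on their joint law across $k$). *)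

(* Defs.v *)
(* Nodes 1, ..., k are the elements of 'I_k, with the
   source (node 1) represented by the ordinal of value 0; discrete time starts
   at 0 in the channel model. *)
From HB Require Import structures.
From mathcomp Require Import all_boot all_order all_algebra.
From mathcomp Require Import all_classical all_reals all_analysis.
From mathcomp Require Import complex.

Set Implicit Arguments.
Unset Strict Implicit.
Unset Printing Implicit Defensive.

Import Order.TTheory GRing.Theory Num.Theory.
Import numFieldNormedType.Exports.

Local Open Scope classical_set_scope.
Local Open Scope ring_scope.
Local Open Scope complex_scope.

(* The Borel sigma-algebra of C, transported from R * R. *)
Definition complex_display : measure_display.
Proof. exact: default_measure_display. Qed.

Section complex_measurable.
Context {R : realType}.

Definition complex_pair (z : R[i]) : measurableTypeR R * measurableTypeR R :=
  (complex.Re z, complex.Im z).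

Definition complex_measurable : set (set R[i]) :=
  preimage_set_system setT complex_pair measurable.

Let sigma_algebra_complex : sigma_algebra setT complex_measurable.
Proof. by apply: sigma_algebra_preimage; exact: sigma_algebra_measurable. Qed.

Let complex_measurable0 : complex_measurable set0.
Proof. by case: sigma_algebra_complex. Qed.

Let complex_measurableC A : complex_measurable A -> complex_measurable (~` A).
Proof. by case: sigma_algebra_complex => _ + _ => /[apply]; rewrite setTD. Qed.

Let complex_measurable_bigcup (F : (set R[i])^nat) :
  (forall i, complex_measurable (F i)) -> complex_measurable (\bigcup_i F i).
Proof. by case: sigma_algebra_complex => _ _; exact. Qed.

HB.instance Definition _ := isPointed.Build R[i] 0.
HB.instance Definition _ := @isMeasurable.Build complex_display R[i]
  complex_measurable complex_measurable0 complex_measurableC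
  complex_measurable_bigcup.

End complex_measurable.

Section independence.
Context {R : realType} {d} {T : measurableType d} (P : probability T R).
Local Open Scope ereal_scope.

(* F i is the set of events of the i-th member of a family indexed by D. *)
Definition mutually_independent (I : eqType) (D : pred I)
    (F : I -> set (set T)) : Prop :=
  forall (s : seq I) (E : I -> set T), uniq s -> {subset s <= D} ->
    (forall i, i \in s -> F i (E i)) ->
    P (\bigcap_(i in [set` s]) E i) = \prod_(i <- s) P (E i).

Definition events_of {d'} {T' : measurableType d'} (X : T -> T') :
  set (set T) := preimage_set_system setT X measurable.

End independence.

Section path_loss.
Context {R : realType}.

Definition euclidean_dist (p q : R * R) : R :=
  Num.sqrt ((p.1 - q.1) ^+ 2 + (p.2 - q.2) ^+ 2).

(* g is a function on the nonnegative reals; its values at negative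
   arguments are irrelevant. *)
Definition path_loss (alpha r0 gbar : R) (g : R -> R) : Prop :=
  [/\ (forall r, 0 <= r -> 0 <= g r),
      (forall r s, 0 <= r -> r <= s -> g s <= g r),
      (forall r, r0 <= r -> g r = r `^ (- alpha)) &
      g 0 <= gbar].

Definition path_gain (g : R -> R) {k} (pos : 'I_k -> R * R) (i j : 'I_k) : R :=
  g (euclidean_dist (pos i) (pos j)).

End path_loss.

Definition is_source {k} (i : 'I_k) : bool := (i : nat) == 0%N.

Section channel.
Context {R : realType}.

Definition abs2 (z : R[i]) : R := complex.Re z ^+ 2 + complex.Im z ^+ 2.

(* CN(0, N0): independent real and imaginary parts of law N(0, N0 / 2);
   the second argument of normal_prob is the standard deviation. *)
Definition complex_normal (N0 : R) (B : set R[i]) : \bar R :=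
  let sigma := Num.sqrt (N0 / 2) in
  (normal_prob 0 sigma \x normal_prob 0 sigma)%E
    [set p : R * R | B (p.1 +i* p.2)].

Record channel (k : nat) {d} {T : measurableType d} (P : probability T R) :=
  Channel {
    fading : 'I_k -> 'I_k -> nat -> {RV P >-> R[i]};
    noise : 'I_k -> nat -> {RV P >-> R[i]} }.

Section channel_model.
Context {k : nat} {d} {T : measurableType d} {P : probability T R}.
Variable ch : channel k P.

(* The sigma-algebra of the whole fading matrix at time t. *)
Definition fading_events (t : nat) : set (set T) :=
  <<s \bigcup_(ij : 'I_k * 'I_k) events_of (fading ch ij.1 ij.2 t) >>.

(* The fading coefficients of a given time are only assumed pairwise
   independent (fading_pairs); the fading matrices of different times and the
   noises are mutually independent (time_noise_indep).  The message needs no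
   random variable: error probability and energy are averaged over it. *)
Record channel_model (N0 : R) (gain : 'I_k -> 'I_k -> R) : Prop := {
  noise_law : forall j t B, measurable B ->
    distribution P (noise ch j t) B = complex_normal N0 B;
  fading_diag : forall i t w, fading ch i i t w = 0;
  fading_circular : forall i j t (theta : R) B, i != j -> measurable B ->
    P [set w | B ((cos theta +i* sin theta) * fading ch i j t w)] =
    distribution P (fading ch i j t) B;
  fading_gain : forall i j t, i != j ->
    (\int[P]_w (abs2 (fading ch i j t w))%:E = (gain i j)%:E)%E;
  fading_time_law : forall i j t t' B, measurable B ->
    distribution P (fading ch i j t) B = distribution P (fading ch i j t') B;
  fading_pairs : forall i j l m t, i != j -> l != m -> (i, j) != (l, m) ->
    forall B B', measurable B -> measurable B' ->
    P (fading ch i j t @^-1` B `&` fading ch l m t @^-1` B') =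
    (P (fading ch i j t @^-1` B) * P (fading ch l m t @^-1` B'))%E;
  time_noise_indep : mutually_independent P predT
    (fun b : nat + 'I_k * nat =>
       match b with
       | inl t => fading_events t
       | inr (j, t) => events_of (noise ch j t)
       end) }.

End channel_model.

(* A relay sees at time t (counted from 0) the t symbols it received before;
   the relay function of the source is never used. *)
Record block_code (k n M : nat) := BlockCode {
  codeword : 'I_M -> n.-tuple R[i];
  relay : 'I_k -> forall t : nat, t.-tuple R[i] -> R[i];
  decoder : 'I_k -> n.-tuple R[i] -> 'I_M;
  relay_measurable : forall i t, measurable_fun setT (@relay i t);
  decoder_measurable : forall i m, measurable (decoder i @^-1` [set m]) }.

Section transmission.
Context {k n M : nat} (c : block_code k n M) (m : 'I_M).
Variables (h : 'I_k -> 'I_k -> nat -> R[i]) (z : 'I_k -> nat -> R[i]).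

Definition input (t : nat) (past : 'I_k -> t.-tuple R[i]) (i : 'I_k) : R[i] :=
  if is_source i then nth 0 (codeword c m) t else relay c i (past i).

Fixpoint received (t : nat) : 'I_k -> t.-tuple R[i] :=
  match t with
  | 0 => fun=> [tuple]
  | t'.+1 => fun j => [tuple of rcons (received t' j)
      (\sum_(i < k) h i j t' * input (received t') i + z j t')]
  end.

Definition transmitted (i : 'I_k) (t : nat) : R[i] := input (received t) i.

End transmission.

Section energy_per_bit.
Context {k : nat} {d} {T : measurableType d} {P : probability T R}.
Variable ch : channel k P.
Local Open Scope ereal_scope.

Definition fading_at (w : T) (i j : 'I_k) (t : nat) : R[i] := fading ch i j t w.

Definition noise_at (w : T) (j : 'I_k) (t : nat) : R[i] := noise ch j t w.

Definition expected_energy {n M} (c : block_code k n M) : \bar R :=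
  (M%:R^-1)%:E * \sum_(m < M) \int[P]_w
    (\sum_(i < k) \sum_(t < n)
       abs2 (transmitted c m (fading_at w) (noise_at w) i t))%R%:E.

Definition error_prob {n M} (c : block_code k n M) : \bar R :=
  (M%:R^-1)%:E * \sum_(m < M) P [set w | exists2 i : 'I_k, ~~ is_source i &
    decoder c i (received c m (fading_at w) (noise_at w) n i) <> m].

Definition code_exists (n M : nat) (Etot eps : R) : Prop :=
  exists c : block_code k n M,
    expected_energy c <= Etot%:E /\ error_prob c <= eps%:E.

(* M = 1 carries no information (infinite energy per bit) and is excluded,
   because division by ln 1 = 0 returns 0. *)
Definition eps_achievable (eps Eb : R) : Prop :=
  forall delta : R, (0 < delta)%R -> exists E0 : R,
  forall Etot : R, (E0 <= Etot)%R -> exists n M : nat,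
    [/\ (1 < M)%N, code_exists n M Etot eps &
        (Etot / (ln M%:R / ln 2) < Eb + delta)%R].

Definition achievable (Eb : R) : Prop :=
  forall eps : R, (0 < eps < 1)%R -> eps_achievable eps Eb.

(* Infimum in the extended reals: +oo if no energy per bit is achievable. *)
Definition Eb_min : \bar R :=
  ereal_inf [set Eb%:E | Eb in [set Eb | (0 <= Eb)%R /\ achievable Eb]].

End energy_per_bit.
End channel.

Section flooding.
Local Open Scope set_scope.
Context {R : realType}.

Record flood_scheme := FloodScheme {
  flood_Eb1 : R;
  flood_Eb2 : R;
  flood_slots : nat;
  flood_Eb1_ge0 : 0 <= flood_Eb1;
  flood_Eb2_ge0 : 0 <= flood_Eb2 }.

Context {k : nat} (N0 : R) (gain : 'I_k -> 'I_k -> R) (S : flood_scheme).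

Definition node_Eb (i : 'I_k) : R :=
  if is_source i then flood_Eb1 S else flood_Eb2 S.

Definition received_Eb (senders : {set 'I_k}) (j : 'I_k) : R :=
  \sum_(i in senders | i != j) gain i j * node_Eb i.

(* State at the end of slot t: the nodes that transmitted in slots 1, ..., t;
   the nodes that know the message; those that learned it in slot t, which
   are the ones that transmit in slot t + 1.  At t = 0 only the source knows
   the message. *)
Record flood_state := FloodState {
  flood_senders : {set 'I_k};
  flood_informed : {set 'I_k};
  flood_fresh : {set 'I_k} }.

Definition flood_init : flood_state :=
  FloodState finset.set0 [set i | is_source i] [set i | is_source i].

Definition flood_step (s : flood_state) : flood_state :=
  let senders := flood_senders s :|: flood_fresh s in
  let fresh := [set j | (j \notin flood_informed s) &&
                        (N0 * ln 2 < received_Eb senders j)] in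
  FloodState senders (flood_informed s :|: fresh) fresh.

Definition flood_after (t : nat) : flood_state := iter t flood_step flood_init.

Definition flood_delivers : Prop :=
  flood_informed (flood_after (flood_slots S)) = [set: 'I_k].

Definition flood_total_Eb : R :=
  \sum_(t < flood_slots S) \sum_(i in flood_fresh (flood_after t)) node_Eb i.

End flooding.
Arguments flood_scheme : clear implicits.

(* The infimum over a sequence of flooding schemes. *)
Definition Eb_flood {R : realType} {k : nat} (N0 : R)
    (gain : 'I_k -> 'I_k -> R) (S : nat -> flood_scheme R) : R :=
  inf (range (fun s => flood_total_Eb N0 gain (S s))).

Section placement.
Context {R : realType}.

Definition square (a : R) : set (R * R) :=
  [set p | 0 <= p.1 <= Num.sqrt a /\ 0 <= p.2 <= Num.sqrt a].

Definition uniform_square (a : R) (B : set (R * R)) : \bar R :=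
  (a^-1%:E * (lebesgue_measure \x lebesgue_measure) (B `&` square a))%E.

Record random_placement {d} {T : measurableType d} (P : probability T R)
    (A : nat -> R) (X : forall k, 'I_k -> {RV P >-> (R * R)%type}) : Prop := {
  placement_source : forall k (i : 'I_k), (2 <= k)%N -> is_source i ->
    forall w, X k i w = (0, 0);
  placement_uniform : forall k (i : 'I_k), (2 <= k)%N -> ~~ is_source i ->
    forall B, measurable B -> distribution P (X k i) B = uniform_square (A k) B;
  placement_indep : forall k, (2 <= k)%N ->
    mutually_independent P [pred i : 'I_k | ~~ is_source i]
      (fun i => events_of (X k i)) }.

End placement.

(* Main.v *)
(* Converse.  Let a receiver j use the decoder of a code with M messages.  By
   the change of measure formula E_Q ln f <= ln E_P f + D(Q || P), with Q the
   law of the received word given message m, P the law of the noise alone, and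
   f = M on {decoded = m}, 1 elsewhere, one gets
     P(j decodes m) ln M <= ln E_P f + (energy received at j) / N0;
   averaging over m, (1 - eps) ln M <= ln 2 + (energy received at j) / N0.
   The transmitters do not know the fading, so the expected energy received at
   j is the sum over i of gain i j times the energy sent by i, and summing over
   j bounds the energy per bit below by ln 2 * N0 * (k - 1) / G, where G bounds
   the total gain from any node to the receivers.

   Placement.  The square is cut into O(A k) cells of area of order r0^2, each
   expected to contain a multiple of (k - 1) r0^2 / A k >> ln k nodes.  By
   Chernoff's bound and Borel-Cantelli, almost surely all counts are eventually
   within constant factors of their means.  Summing the path loss over rings of
   cells gives G = O((k - 1) / A k).

   Flooding.  With cells so small that adjacent ones lie within distance r0, the
   nodes of a cell that know the message together inform all adjacent cells, so
   the message spreads from the corner to the whole square cell by cell. *)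

Require Import Defs.
From HB Require Import structures.
From mathcomp Require Import all_boot all_order all_algebra.
From mathcomp Require Import all_classical all_reals all_analysis.
From mathcomp Require Import measurable_realfun complex ring lra zify.

Set Implicit Arguments.
Unset Strict Implicit.
Unset Printing Implicit Defensive.

Import Order.TTheory GRing.Theory Num.Theory.
Import numFieldNormedType.Exports.

Local Open Scope classical_set_scope.
Local Open Scope ring_scope.

(** * Independence *)

(** The received word has no tractable law: inputs depend on past outputs, hence on past fading and
    noise. So neither a density nor a divergence on words is ever formed. The change of measure is
    proved for one real Gaussian variable, and the chain rule for divergence becomes an induction on
    time: once everything before the noise at time [t] is fixed, the fading at time [t] included,
    the last symbol is a Gaussian shifted by a constant, and the function of the word is replaced by
    its mean over that symbol. This needs each noise symbol to be independent of the whole past,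
    which is derived here from independence of finite families of events. The divergence only
    involves energies, that is second moments, so pairwise independence of simultaneous fading
    coefficients is enough.

    Two systems of cells are used: upper bounds on counts tolerate cells that stick out of the
    square, while lower bounds need cells of equal area inside it. *)

Section independence_theory.
Context {R : realType} {d} {T : measurableType d} (P : probability T R).
Local Open Scope ereal_scope.

(** Independence makes the law of [(U, V)] the product of the two laws, to which Tonelli applies.
    [S1] and [S2] may be [T] itself with a smaller sigma-algebra, [U] and [V] being the identity:
    integrating over [V] first then plays the role of conditioning on [U]. *)
Lemma indep_fubini {d1 d2} {S1 : measurableType d1} {S2 : measurableType d2}
    (U : T -> S1) (V : T -> S2) (phi : (S1 * S2)%type -> \bar R) :
  measurable_fun setT U -> measurable_fun setT V ->
  (forall A B, measurable A -> measurable B ->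
     P (U @^-1` A `&` V @^-1` B) = P (U @^-1` A) * P (V @^-1` B)) ->
  measurable_fun setT phi -> (forall x, 0 <= phi x) ->
  \int[P]_w phi (U w, V w) = \int[P]_w \int[P]_w' phi (U w, V w').
Proof.
move=> mU mV UV mphi phi0.
pose U' : {mfun T >-> S1} := HB.pack U (isMeasurableFun.Build _ _ _ _ _ mU).
pose V' : {mfun T >-> S2} := HB.pack V (isMeasurableFun.Build _ _ _ _ _ mV).
pose UV' : {mfun T >-> (S1 * S2)%type} := HB.pack (fun w => (U w, V w))
  (isMeasurableFun.Build _ _ _ _ _ (measurable_fun_pair mU mV)).
have prodE X : measurable X ->
    (distribution P U' \x distribution P V') X = distribution P UV' X.
  by apply: product_measure_unique => A B mA mB; rewrite /= -UV.
transitivity (\int[distribution P UV']_z phi z).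
  by rewrite ge0_integral_distribution.
rewrite -(eq_measure_integral (distribution P UV')
  (m1 := (distribution P U' \x distribution P V'))); last first.
  by move=> A mA _; exact: prodE.
rewrite fubini_tonelli1// ge0_integral_distribution//=; last 2 first.
  exact: measurable_fun_fubini_tonelli_F.
  by move=> x; exact: integral_ge0.
apply: eq_integral => w _ /=; rewrite /fubini_F ge0_integral_distribution//.
exact/measurableT_comp.
Qed.

Section grouping.
Context {I : eqType} (F : I -> set (set T)).
Hypothesis F_sigma : forall b, sigma_algebra setT (F b).
Hypothesis F_meas : forall b, F b `<=` measurable.
Hypothesis F_indep : mutually_independent P predT F.

Let FT b : F b setT.
Proof.
by have [F0 FC _] := F_sigma b; rewrite -(setD0 setT); exact: FC.
Qed.

Let FI b A B : F b A -> F b B -> F b (A `&` B).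
Proof.
have [F0 FC FU] := F_sigma b => FA FB.
have FC' E : F b E -> F b (~` E) by move=> /FC; rewrite setTD.
rewrite -(setCK (A `&` B)) setCI; apply: (FC').
rewrite -bigcup2E; apply: FU => -[|[|n]]; rewrite /bigcup2 /=.
- exact: FC'.
- exact: FC'.
- exact: F0.
Qed.

(** The finite intersections of events indexed by [D]: a pi-system generating the same sigma-algebra
    as their union. *)
Let cyl (D : pred I) : set (set T) := [set A | exists (s : seq I) (E : I -> set T),
  [/\ uniq s, {subset s <= D}, (forall b, b \in s -> F b (E b)) &
     A = \bigcap_(b in [set` s]) E b]].

Let cylI D : setI_closed (cyl D).
Proof.
move=> _ _ [s1 [E1 [u1 D1 F1 ->]]] [s2 [E2 [u2 D2 F2 ->]]].
(* Both families are extended by [setT] outside their index lists, so that they can be intersected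
   over the merged list. *)
pose ex (s : seq I) (E : I -> set T) b := if b \in s then E b else setT.
exists (undup (s1 ++ s2)), (fun b => ex s1 E1 b `&` ex s2 E2 b); split.
- exact: undup_uniq.
- by move=> b; rewrite mem_undup mem_cat => /orP[/D1|/D2].
- by move=> b _; apply: FI; rewrite /ex; case: ifPn => // ?; auto.
- apply/seteqP; split=> [w [h1 h2] b _|w h].
    by split; rewrite /ex; case: ifPn => // ?; [exact: h1|exact: h2].
  split=> b bs.
    have /h[] : [set` undup (s1 ++ s2)] b.
      by rewrite /= mem_undup mem_cat bs.
    by rewrite /ex bs.
  have /h[_] : [set` undup (s1 ++ s2)] b by rewrite /= mem_undup mem_cat bs orbT.
  by rewrite /ex bs.
Qed.

Let cyl_meas D : cyl D `<=` measurable.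
Proof.
move=> _ [s [E [us _ FE ->]]].
elim: s us FE => [|b s IH] /=.
  by move=> _ _; rewrite (_ : \bigcap_(_ in _) _ = setT)//; apply/seteqP; split.
move=> /andP[_ us] FE.
rewrite (_ : \bigcap_(_ in _) _ = E b `&` \bigcap_(c in [set` s]) E c).
  apply: measurableI; first by apply: F_meas; apply: FE; rewrite mem_head.
  by apply: IH => // c cs; apply: FE; rewrite in_cons cs orbT.
apply/seteqP; split=> [w h|w [h1 h2] c /=].
  by split=> [|c cs]; apply: h; rewrite /= in_cons ?eqxx//; apply/orP; right.
by rewrite in_cons => /orP[/eqP ->//|]; exact: h2.
Qed.

(** For fixed [B], both [P (A & B)] and [P A * P B] are finite measures in [A]; they agree on the
    pi-system [cyl D], hence on the sigma-algebra it generates. *)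
Lemma mutually_independent_group (D : pred I) (b0 : I) A B : ~~ D b0 ->
  <<s \bigcup_(b in [set b | D b]) F b >> A -> F b0 B ->
  P (A `&` B) = P A * P B.
Proof.
move=> Db0 sA FB; have mB := F_meas FB.
have {}sA : <<s cyl D >> A.
  move: A sA; apply: smallest_sub; first exact: smallest_sigma_algebra.
  move=> A [b /= Db FA]; apply: sub_sigma_algebra.
  exists [:: b], (fun=> A); split => //.
  - by move=> c; rewrite inE => /eqP ->.
  - by move=> c; rewrite inE => /eqP ->.
  - apply/seteqP; split=> [w Aw c _//|w h].
    by apply: (h b); rewrite /= inE.
pose k : {nonneg R} := NngNum (fine_ge0 (measure_ge0 P B)).
have kE X : P X * P B = mscale k P X.
  by rewrite muleC /mscale /= fineK// fin_num_measure.
rewrite kE; transitivity (mrestr P mB A); first by [].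
apply: (@g_sigma_algebra_measure_unique _ R T (cyl D) (@cyl_meas D) (fun=> setT)
  _ _ (mrestr P mB) (mscale k P) (@cylI D) _ _ A sA).
- by move=> _; exists [::], (fun=> setT); split=> //; apply/seteqP; split.
- by rewrite bigcup_const.
- move=> _ [s [E [us sD FE ->]]].
  rewrite -[RHS]/(mscale k P (\bigcap_(b in [set` s]) E b)) -kE.
  rewrite -[LHS]/(P (\bigcap_(b in [set` s]) E b `&` B)).
  have b0s : b0 \notin s by apply: contra Db0 => /sD.
  pose E' b := if b == b0 then B else E b.
  have E'E b : b \in s -> E' b = E b.
    by move=> bs; rewrite /E'; case: eqP => // e; rewrite e (negbTE b0s) in bs.
  have := F_indep (s := b0 :: s) (E := E').
  rewrite /= b0s us => /(_ isT) /(_ _) h.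
  rewrite big_cons /E' eqxx -/E' in h.
  have -> : \bigcap_(b in [set` s]) E b `&` B =
      \bigcap_(i in [set` b0 :: s]) E' i.
    apply/seteqP; split=> [w [h1 h2] c /=|w h1].
      rewrite in_cons => /orP[/eqP ->|cs]; first by rewrite /E' eqxx.
      by rewrite E'E//; exact: h1.
    split=> [c cs|].
      by rewrite -E'E//; apply: h1; rewrite /= in_cons cs orbT.
    have /h1 : [set` b0 :: s] b0 by rewrite /= mem_head.
    by rewrite /E' eqxx.
  rewrite h; last 2 first.
    by move=> c; rewrite inE.
    move=> c; rewrite in_cons => /orP[/eqP ->|cs]; first by rewrite eqxx.
    by have /= := E'E c cs; rewrite /E' => ->; exact: FE.
  rewrite muleC; congr (_ * _).
  rewrite (F_indep (s := s))//; apply: eq_big_seq => c cs.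
  by have /= := E'E c cs; rewrite /E' => ->.
- move=> _; apply: (@le_lt_trans _ _ (1 : \bar R) _ _ _ (ltry 1)).
  by apply: (probability_le1 P (A := setT `&` B)); exact: measurableI.
Qed.

End grouping.
End independence_theory.

(** * Change of measure for Gaussian shifts *)

Section gaussian_shift.
Context {R : realType}.
Local Open Scope ereal_scope.
Local Notation leb := (@lebesgue_measure R).

Lemma lebesgue_integral_translation (s : R) (f : R -> \bar R) :
  measurable_fun setT f -> (forall x, 0 <= f x) ->
  \int[leb]_x f (x + s)%R = \int[leb]_x f x.
Proof.
move=> mf f0.
have ms : measurable_fun [set: measurableTypeR R] (fun x : R => (x + s)%R : measurableTypeR R).
  exact: measurable_funD.
pose S : {mfun measurableTypeR R >-> measurableTypeR R} :=
  HB.pack (fun x : R => (x + s)%R) (isMeasurableFun.Build _ _ _ _ _ ms).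
have E X : measurable X -> leb X = pushforward leb S X.
  apply: lebesgue_measure_unique => _ [[a b] _ <-] /=.
  rewrite /pushforward.
  rewrite (_ : _ @^-1` _ = `](a - s)%R, (b - s)%R]%classic); last first.
    apply/seteqP; split=> x /=; rewrite !in_itv/=.
      by move=> /andP[? ?]; apply/andP; split; lra.
    by move=> /andP[? ?]; apply/andP; split; lra.
  rewrite !lebesgue_measure_itv/= !lte_fin ltrD2r.
  by case: ifPn => // _; rewrite -!EFinB; congr (_%:E); lra.
transitivity (\int[pushforward leb S]_x f x).
  by rewrite ge0_integral_pushforward.
by apply: eq_measure_integral => A mA _; exact/esym/E.
Qed.

(** [normal_pdf] and the Radon-Nikodym derivative have the same integral over every measurable set,
    so they agree almost everywhere. *)
Lemma ge0_integral_normal_prob (m s : R) (f : R -> \bar R) :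
  measurable_fun setT f -> (forall x, 0 <= f x) ->
  \int[normal_prob m s]_x f x = \int[leb]_x (f x * (normal_pdf m s x)%:E).
Proof.
move=> mf f0; pose N : {finite_measure set (measurableTypeR R) -> \bar R} := normal_prob m s.
have dom : N `<< leb by exact: normal_prob_dominates.
rewrite -(Radon_Nikodym_SigmaFinite.change_of_variables dom)//.
apply: ae_eq_integral => //.
- apply: emeasurable_funM => //.
  exact: measurable_int (Radon_Nikodym_SigmaFinite.f_integrable _).
- by apply: emeasurable_funM => //; apply/measurable_EFinP; exact: measurable_normal_pdf.
- apply: ae_eqe_mul2l; apply: integral_ae_eq => //.
  + exact: Radon_Nikodym_SigmaFinite.f_integrable.
  + by apply/measurable_EFinP; exact: measurable_normal_pdf.
  + by move=> A _ mA; rewrite -Radon_Nikodym_SigmaFinite.f_integral.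
Qed.

(** The density of N(-s, sigma^2) with respect to N(0, sigma^2), that is, the Gaussian density at
    [z + s] divided by the one at [z]. *)
Definition shift_density (sigma s z : R) : R :=
  expR (- (2 * s * z + s ^+ 2) / (sigma ^+ 2 *+ 2)).

Lemma measurable_shift_density sigma s :
  measurable_fun setT (shift_density sigma s).
Proof.
apply: measurableT_comp => //; apply: measurable_funM => //.
by apply: measurableT_comp => //; apply: measurable_funD => //.
Qed.

Lemma ge0_integral_normal_shift (sigma s : R) (f : R -> \bar R) :
  (sigma != 0)%R -> measurable_fun setT f -> (forall x, 0 <= f x) ->
  \int[normal_prob 0 sigma]_z (f (z + s)%R * (shift_density sigma s z)%:E) =
  \int[normal_prob 0 sigma]_z f z.
Proof.
move=> sigma0 mf f0.
have mfs : measurable_fun setT (fun z : R => f (z + s)%R).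
  by apply: measurableT_comp => //; exact: measurable_funD.
rewrite ge0_integral_normal_prob//; last 2 first.
- by apply: emeasurable_funM => //; apply/measurable_EFinP; exact: measurable_shift_density.
- by move=> x; rewrite mule_ge0// lee_fin expR_ge0.
rewrite ge0_integral_normal_prob//.
rewrite -[RHS](lebesgue_integral_translation s); last 2 first.
- by apply: emeasurable_funM => //; apply/measurable_EFinP; exact: measurable_normal_pdf.
- by move=> x; rewrite mule_ge0// lee_fin normal_pdf_ge0.
apply: eq_integral => x _; rewrite -muleA -EFinM; congr (_ * _%:E).
rewrite !normal_pdfE// /normal_fun /shift_density mulrCA -expRD.
by congr (_ * expR _)%R; rewrite -mulrDl; congr (_ / _)%R; ring.
Qed.

Lemma ln_leB1 (x : R) : (0 < x -> ln x <= x - 1)%R.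
Proof.
by move=> x0; have := @le_ln1Dx R (x - 1)%R; rewrite subrKC; apply; lra.
Qed.

Lemma Rintegral_prob_cst {d} {T : measurableType d} (P : probability T R) (r : R) :
  (\int[P]_x r = r)%R.
Proof.
rewrite Rintegral_cst//.
have -> : fine (P setT) = 1%R by rewrite -[1%R]/(fine 1%E) -(probability_setT P).
by rewrite mulr1.
Qed.

Lemma prob_bounded_integrable {d} {T : measurableType d} (P : probability T R)
    (f : T -> R) (K : R) :
  measurable_fun setT f -> (forall x, (`|f x| <= K)%R) ->
  P.-integrable setT (EFin \o f).
Proof.
move=> mf fK; apply: measurable_bounded_integrable => //.
  by apply: (le_lt_trans (probability_le1 P measurableT)); rewrite ltry.
by exists K; split=> [|y Ky x _ /=]; [exact: num_real|exact: le_trans (ltW Ky)].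
Qed.

Lemma Rintegral_prob_bounds {d} {T : measurableType d} (P : probability T R)
    (f : T -> R) (a b : R) :
  P.-integrable setT (EFin \o f) -> (forall x, (a <= f x <= b)%R) ->
  (a <= \int[P]_x f x <= b)%R.
Proof.
move=> fi fab; apply/andP; split.
  rewrite -[leLHS](Rintegral_prob_cst P); apply: le_Rintegral => //.
    exact: (@prob_bounded_integrable _ _ P _ `|a|%R).
  by move=> x _; have /andP[] := fab x.
rewrite -[leRHS](Rintegral_prob_cst P); apply: le_Rintegral => //.
  exact: (@prob_bounded_integrable _ _ P _ `|b|%R).
by move=> x _; have /andP[] := fab x.
Qed.

Lemma EFin_Rintegral {d} {T : measurableType d} (P : probability T R)
    (f : T -> R) :
  P.-integrable setT (EFin \o f) ->
  (\int[P]_x f x)%R%:E = \int[P]_x (f x)%:E.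
Proof. by move=> fi; rewrite /Rintegral fineK//; exact: integrable_fin_num. Qed.

Section fixed_sigma.
Variables (sigma : R) (sigma0 : (sigma != 0)%R).
Local Notation N := (normal_prob 0 sigma).

Let s2 : (0 < sigma ^+ 2 *+ 2)%R.
Proof. by rewrite pmulrn_lgt0// exprn_even_gt0. Qed.

Lemma integral_shift_density s : \int[N]_z (shift_density sigma s z)%:E = 1.
Proof.
transitivity (\int[N]_z (cst 1 (z + s)%R * (shift_density sigma s z)%:E)).
  by apply: eq_integral => x _; rewrite mul1e.
rewrite (@ge0_integral_normal_shift sigma s (cst 1))//.
by rewrite integral_cst//= [normal_prob _ _ _]probability_setT mule1.
Qed.

Lemma integrable_shift_density s :
  N.-integrable setT (EFin \o shift_density sigma s).
Proof.
apply/integrableP; split.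
  by apply/measurable_EFinP; exact: measurable_shift_density.
under eq_integral do rewrite /= ger0_norm ?expR_ge0//.
by rewrite integral_shift_density ltry.
Qed.

(** [z] is dominated by [expR z + expR (- z)], and each exponential is a constant multiple of a
    shift density, with shift [sigma ^+ 2] or its opposite. *)
Lemma integrable_normal_id : N.-integrable setT (EFin \o (id : R -> R)).
Proof.
pose k := expR (sigma ^+ 2 / 2).
pose g := (k \o* (shift_density sigma (sigma ^+ 2) \+
                  shift_density sigma (- sigma ^+ 2)))%R.
have shE (e z : R) : (e ^+ 2 = 1)%R ->
    (shift_density sigma (e * sigma ^+ 2) z * k)%R = expR (- e * z)%R.
  move=> e1; rewrite /shift_density /k -expRD; congr expR.
  rewrite exprMn e1 mul1r; field.
  by move: s2; rewrite pmulrn_lgt0// => /lt0r_neq0; rewrite sqrf_eq0.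
have abs_expR (z : R) :
    (- `|expR z + expR (- z)| <= z <= `|expR z + expR (- z)|)%R.
  rewrite ger0_norm ?addr_ge0 ?expR_ge0//.
  have := expR_ge1Dx z; have := expR_ge1Dx (- z)%R.
  by have := expR_ge0 z; have := expR_ge0 (- z)%R; move=> *; apply/andP; split; lra.
apply: (@le_integrable _ _ _ N setT measurableT _ (EFin \o g)).
- by apply/measurable_EFinP; exact: measurable_id.
- move=> z _; rewrite /= lee_fin ler_norml.
  have -> : g z = (expR z + expR (- z))%R.
    rewrite /g /= mulrDl.
    have := shE 1%R z; rewrite expr1n mul1r => -> //.
    have := shE (-1)%R z; rewrite sqrrN expr1n mulN1r => -> //.
    by rewrite addrC mulN1r opprK mul1r.
  exact: abs_expR.
- rewrite (_ : EFin \o g = (fun x => k%:E * ((EFin \o shift_density sigma (sigma ^+ 2))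
    \+ (EFin \o shift_density sigma (- sigma ^+ 2))) x)); last first.
    by apply/funext => x; rewrite /= -EFinD -EFinM mulrC.
  apply: integrableZl => //.
  by apply: integrableD => //; exact: integrable_shift_density.
Qed.

(* Taking s = - m in the bound 1 = E (density) >= 1 - (2 s m + s^2) / (2 sigma^2). *)
Lemma Rintegral_normal_id : (\int[N]_z z = 0)%R.
Proof.
set m := (\int[N]_z z)%R.
pose v : R := (sigma ^+ 2 *+ 2)%R.
pose f z : R := (1 - m ^+ 2 / v + (2 * m / v) * z)%R.
have i1 : N.-integrable setT (EFin \o cst (1 - m ^+ 2 / v)%R).
  by apply: (@prob_bounded_integrable _ _ N _ `|(1 - m ^+ 2 / v)|%R).
have i2 : N.-integrable setT (EFin \o (fun z : R => 2 * m / v * z)%R).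
  by apply: eq_integrable (integrableZl measurableT (2 * m / v)%R integrable_normal_id).
have fi : N.-integrable setT (EFin \o f).
  by apply: eq_integrable (integrableD measurableT i1 i2).
have f_le z : (f z <= shift_density sigma (- m) z)%R.
  apply: le_trans (expR_ge1Dx _).
  suff -> : f z = (1 + - (2 * - m * z + (- m) ^+ 2) / v)%R by [].
  by rewrite /f; ring.
have := @le_Rintegral _ _ _ N setT f _ measurableT fi
  (integrable_shift_density (- m)) (fun z _ => f_le z).
rewrite [X in (_ <= X)%R -> _]/Rintegral integral_shift_density /= /f.
rewrite RintegralD// Rintegral_prob_cst RintegralZl//; last exact: integrable_normal_id.
rewrite -/m => h.
have : (m ^+ 2 / v <= 0)%R by lra.
rewrite ler_pdivrMr// mul0r => m0; apply/eqP; rewrite -sqrf_eq0.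
by rewrite eq_le m0 sqr_ge0.
Qed.

Section bounded.
Variables (K : R) (f : R -> R).
Hypotheses (mf : measurable_fun setT f) (f1K : forall x, (1 <= f x <= K)%R).

Let f_gt0 x : (0 < f x)%R.
Proof. by have /andP[h _] := f1K x; exact: lt_le_trans h. Qed.

(* The last term is the divergence of N(s, sigma^2) from N(0, sigma^2); the
   proof applies ln x <= x - 1 to x = f (z + s) * shift_density z / E f. *)
Lemma le_integral_ln_normal_shift s :
  \int[N]_z (ln (f (z + s)))%:E <=
  (ln (\int[N]_z f z)%R + s ^+ 2 / (sigma ^+ 2 *+ 2))%R%:E.
Proof.
have K1 : (1 <= K)%R by have /andP[h1 h2] := f1K 0%R; exact: le_trans h2.
have ms : measurable_fun setT (fun z : R => z + s)%R by exact: measurable_funD.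
have mfs : measurable_fun setT (fun z : R => f (z + s)%R).
  exact: (measurableT_comp mf ms).
have fi : N.-integrable setT (EFin \o f).
  apply: (@prob_bounded_integrable _ _ N _ K) => // x.
  by have /andP[h1 h2] := f1K x; rewrite ger0_norm// ltW.
set C := (\int[N]_z f z)%R.
have C1 : (1 <= C)%R.
  rewrite -[leLHS](Rintegral_prob_cst N).
  apply: le_Rintegral => //.
    by apply: (@prob_bounded_integrable _ _ N _ 1%R) => // x; rewrite normr1.
  by move=> x _; have /andP[] := f1K x.
have C0 : (0 < C)%R by exact: lt_le_trans C1.
pose v : R := (sigma ^+ 2 *+ 2)%R.
pose fp z := (f (z + s) * shift_density sigma s z)%R.
have fpE : \int[N]_z (fp z)%:E = C%:E.
  rewrite /fp; under eq_integral do rewrite EFinM.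
  rewrite (@ge0_integral_normal_shift sigma s (EFin \o f))//.
  - by rewrite EFin_Rintegral.
  - exact/measurable_EFinP.
  - by move=> x; rewrite lee_fin ltW.
have fpi : N.-integrable setT (EFin \o fp).
  apply/integrableP; split.
    apply/measurable_EFinP; apply: measurable_funM => //.
    exact: measurable_shift_density.
  under eq_integral.
    move=> x _; rewrite /= ger0_norm; last by rewrite mulr_ge0 ?expR_ge0// ltW.
    over.
  by rewrite /= fpE ltry.
(* What [ln x <= x - 1] leaves on the right of [ln (f (z + s))]. The logarithm of the shift density
   is affine in [z], and its linear term has mean 0. *)
pose g z : R := (C^-1 * fp z + ((ln C - 1 + s ^+ 2 / v) + (2 * s / v) * z))%R.
have i1 : N.-integrable setT (EFin \o (fun z => C^-1 * fp z)%R).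
  by apply: eq_integrable (integrableZl measurableT C^-1 fpi).
have i2 : N.-integrable setT (EFin \o cst (ln C - 1 + s ^+ 2 / v)%R).
  by apply: (@prob_bounded_integrable _ _ N _ `|(ln C - 1 + s ^+ 2 / v)|%R).
have i3 : N.-integrable setT (EFin \o (fun z : R => 2 * s / v * z)%R).
  by apply: eq_integrable (integrableZl measurableT (2 * s / v)%R integrable_normal_id).
have i23 : N.-integrable setT (EFin \o (fun z : R => (ln C - 1 + s ^+ 2 / v) + (2 * s / v) * z)%R).
  by apply: eq_integrable (integrableD measurableT i2 i3).
have gi : N.-integrable setT (EFin \o g).
  by apply: eq_integrable (integrableD measurableT i1 i23).
have lni : N.-integrable setT (EFin \o (fun z : R => ln (f (z + s)))%R).
  apply: (@prob_bounded_integrable _ _ N _ (ln K)).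
    exact: (measurableT_comp (@measurable_ln R) mfs).
  move=> x; have /andP[h1 h2] := f1K (x + s)%R.
  by rewrite ger0_norm ?ln_ge0// ler_ln// posrE; [exact: lt_le_trans h1|exact: lt_le_trans K1].
rewrite -EFin_Rintegral// lee_fin.
have -> : (ln C + s ^+ 2 / v = \int[N]_z g z)%R.
  rewrite /g RintegralD// RintegralZl// RintegralD// Rintegral_prob_cst RintegralZl//; last first.
    exact: integrable_normal_id.
  rewrite Rintegral_normal_id {1}/Rintegral fpE /=.
  by rewrite mulVf ?gt_eqF//; ring.
apply: le_Rintegral => // z _.
have fp0 : (0 < C^-1 * fp z)%R by rewrite !mulr_gt0 ?invr_gt0 ?expR_gt0.
have := ln_leB1 fp0.
rewrite lnM ?posrE ?invr_gt0//; last by rewrite mulr_gt0 ?expR_gt0.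
rewrite lnV ?posrE// /fp lnM ?posrE ?expR_gt0// expRK -/(fp z) => h.
rewrite /g.
suff -> : ((ln C - 1 + s ^+ 2 / v) + (2 * s / v) * z =
   ln C - 1 - (- (2 * s * z + s ^+ 2) / v))%R by move: h; rewrite /fp -/v; lra.
by ring.
Qed.

End bounded.
End fixed_sigma.

Section complex_shift.
Variables (sigma : R) (sigma0 : (sigma != 0)%R).
Local Notation N := (normal_prob 0 sigma).
Variables (K : R) (f : measurableTypeR R * measurableTypeR R -> R).
Hypotheses (mf : measurable_fun setT f) (f1K : forall x, (1 <= f x <= K)%R).

(** The real inequality is used twice: on [f (a, _)] for fixed [a], which produces the logarithm of
    the partial mean [G a], then on [G], which satisfies the same bounds as [f]. *)
Lemma le_integral_ln_normal_shift2 (s1 s2 : R) :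
  \int[N \x N]_z (ln (f (z.1 + s1, z.2 + s2)%R))%:E <=
  (ln (fine (\int[N \x N]_z (f z)%:E)) +
   (s1 ^+ 2 + s2 ^+ 2) / (sigma ^+ 2 *+ 2))%R%:E.
Proof.
pose G a := (\int[N]_b f (a, b))%R.
have fabs x : (`|f x| <= K)%R.
  by have /andP[h1 h2] := f1K x; rewrite ger0_norm// (le_trans _ h1).
have mfa a : measurable_fun setT (fun b => f (a, b)).
  exact: measurableT_comp.
have fai a : N.-integrable setT (EFin \o (fun b => f (a, b))).
  exact: (@prob_bounded_integrable _ _ N _ K).
have GE a : (G a)%:E = \int[N]_b (f (a, b))%:E.
  by rewrite EFin_Rintegral.
have G1K a : (1 <= G a <= K)%R by exact: Rintegral_prob_bounds.
have mG : measurable_fun setT G.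
  apply/measurable_EFinP.
  rewrite (_ : EFin \o G = fubini_F N (EFin \o f)); last first.
    by apply/funext => a; rewrite /= GE.
  apply: measurable_fun_fubini_tonelli_F; first exact/measurable_EFinP.
  by move=> x; rewrite lee_fin (le_trans ler01)//; have /andP[] := f1K x.
have mfs : measurable_fun setT (fun z : measurableTypeR R * measurableTypeR R
  => f (z.1 + s1, z.2 + s2)%R).
  apply: measurableT_comp => //.
  by apply: measurable_fun_pair; exact: measurable_funD.
rewrite (fubini_tonelli1 (fun z : measurableTypeR R * measurableTypeR R =>
    (ln (f (z.1 + s1, z.2 + s2)%R))%:E)); last 2 first.
- by apply/measurable_EFinP; exact: (measurableT_comp (@measurable_ln R) mfs).
- by move=> x; rewrite lee_fin ln_ge0//; have /andP[] := f1K (x.1 + s1, x.2 + s2)%R.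
rewrite /fubini_F /=.
have lnG0 x : (0 <= ln (G x))%R by rewrite ln_ge0//; have /andP[] := G1K x.
have v0 : (0 <= (sigma ^+ 2 *+ 2)^-1)%R by rewrite invr_ge0 mulrn_wge0// sqr_ge0.
have mlnG : measurable_fun setT (fun x : R => (ln (G (x + s1)))%:E).
  apply/measurable_EFinP; apply: (measurableT_comp (@measurable_ln R)).
  by apply: (measurableT_comp mG); exact: measurable_funD.
apply: (@le_trans _ _ (\int[N]_x ((ln (G (x + s1)))%:E + (s2 ^+ 2 / (sigma ^+ 2 *+ 2))%R%:E))).
  apply: ge0_le_integral => //.
  - move=> x _; apply: integral_ge0 => y _; rewrite lee_fin ln_ge0//.
    by have /andP[] := f1K (x + s1, y + s2)%R.
  - apply: (measurable_fun_fubini_tonelli_F (fun z : measurableTypeR R * measurableTypeR R =>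
    (ln (f (z.1 + s1, z.2 + s2)%R))%:E)).
      by apply/measurable_EFinP; exact: (measurableT_comp (@measurable_ln R) mfs).
    by move=> x; rewrite lee_fin ln_ge0//; have /andP[] := f1K (x.1 + s1, x.2 + s2)%R.
  - exact: emeasurable_funD.
  - move=> x _; rewrite -EFinD.
    exact: (le_integral_ln_normal_shift sigma0 (mfa (x + s1)%R) (fun y => f1K (x + s1, y)%R)).
rewrite ge0_integralD//; last 2 first.
- by move=> x _; rewrite lee_fin.
- by move=> x _; rewrite lee_fin mulr_ge0// sqr_ge0.
rewrite -[X in _ + X](@EFin_Rintegral _ _ N (cst (s2 ^+ 2 / (sigma ^+ 2 *+ 2))%R)); last first.
  exact: (@prob_bounded_integrable _ _ N _ `|(s2 ^+ 2 / (sigma ^+ 2 *+ 2))|%R).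
rewrite (Rintegral_prob_cst N).
have -> : fine (\int[N \x N]_z (f z)%:E) = (\int[N]_a G a)%R.
  rewrite (fubini_tonelli1 (EFin \o f)).
  - by rewrite /fubini_F /= /Rintegral; congr fine; apply: eq_integral => a _; rewrite GE.
  - exact/measurable_EFinP.
  - by move=> x; rewrite lee_fin (le_trans ler01)//; have /andP[] := f1K x.
rewrite mulrDl addrA EFinD leeD2r//.
exact: (le_integral_ln_normal_shift sigma0 mG G1K).
Qed.

End complex_shift.
End gaussian_shift.

(** * Measurability of complex arithmetic *)

Section complex_measurability.
Context {R : realType}.
Local Open Scope complex_scope.

Lemma measurable_complex_pair : measurable_fun setT (@complex_pair R).
Proof. by move=> _ B mB; rewrite setTI; exists B => //; rewrite setTI. Qed.

Lemma measurable_Re : measurable_fun setT (@complex.Re R : R[i] -> measurableTypeR R).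
Proof. exact: (measurableT_comp measurable_fst measurable_complex_pair). Qed.

Lemma measurable_Im : measurable_fun setT (@complex.Im R : R[i] -> measurableTypeR R).
Proof. exact: (measurableT_comp measurable_snd measurable_complex_pair). Qed.

Context {d} {U : measurableType d}.

Lemma measurable_fun_complex (f : U -> R[i]) :
  measurable_fun setT (fun u => complex.Re (f u)) ->
  measurable_fun setT (fun u => complex.Im (f u)) ->
  measurable_fun setT f.
Proof.
move=> mRe mIm _ _ [B mB <-]; rewrite setTI.
by have := measurable_fun_pair mRe mIm measurableT mB; rewrite !setTI.
Qed.

Lemma measurable_complexD (f g : U -> R[i]) :
  measurable_fun setT f -> measurable_fun setT g ->
  measurable_fun setT (fun u => f u + g u).
Proof.
move=> mf mg; apply: measurable_fun_complex.
  rewrite (_ : (fun u => _) = (fun u => complex.Re (f u) + complex.Re (g u))).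
    by apply: measurable_funD; exact: (measurableT_comp measurable_Re).
  by apply/funext => u; case: (f u) (g u) => [? ?] [? ?].
rewrite (_ : (fun u => _) = (fun u => complex.Im (f u) + complex.Im (g u))).
  by apply: measurable_funD; exact: (measurableT_comp measurable_Im).
by apply/funext => u; case: (f u) (g u) => [? ?] [? ?].
Qed.

Lemma measurable_complexM (f g : U -> R[i]) :
  measurable_fun setT f -> measurable_fun setT g ->
  measurable_fun setT (fun u => f u * g u).
Proof.
move=> mf mg.
have mRef := measurableT_comp measurable_Re mf.
have mImf := measurableT_comp measurable_Im mf.
have mReg := measurableT_comp measurable_Re mg.
have mImg := measurableT_comp measurable_Im mg.
apply: measurable_fun_complex.
  rewrite (_ : (fun u => _) = (fun u => complex.Re (f u) * complex.Re (g u) -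
     complex.Im (f u) * complex.Im (g u))).
    by apply: measurable_funB; exact: measurable_funM.
  by apply/funext => u; case: (f u) (g u) => [? ?] [? ?].
rewrite (_ : (fun u => _) = (fun u => complex.Re (f u) * complex.Im (g u) +
     complex.Im (f u) * complex.Re (g u))).
  by apply: measurable_funD; exact: measurable_funM.
by apply/funext => u; case: (f u) (g u) => [? ?] [? ?].
Qed.

Lemma measurable_complex_sum (I : Type) (s : seq I) (f : I -> U -> R[i]) :
  (forall i, measurable_fun setT (f i)) ->
  measurable_fun setT (fun u => \sum_(i <- s) f i u).
Proof.
move=> mf; elim: s => [|i s IH].
  by under eq_fun do rewrite big_nil; exact: measurable_cst.
by under eq_fun do rewrite big_cons; exact: measurable_complexD.
Qed.

Lemma measurable_abs2 (f : U -> R[i]) :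
  measurable_fun setT f -> measurable_fun setT (fun u => abs2 (f u)).
Proof.
move=> mf; apply: measurable_funD; apply: measurable_funX.
  exact: (measurableT_comp measurable_Re).
exact: (measurableT_comp measurable_Im).
Qed.

End complex_measurability.

(** * Measurability and causality of the transmission *)

Lemma measurable_rcons {d1 d2} {U : measurableType d1} {V : measurableType d2}
    n (f : U -> n.-tuple V) (g : U -> V) :
  measurable_fun setT f -> measurable_fun setT g ->
  measurable_fun setT (fun u => [tuple of rcons (f u) (g u)]).
Proof.
move=> mf mg; apply/measurable_fun_tnthP => i.
have [iltn|nlei] := ltnP i n.
  rewrite (_ : _ \o _ = (fun u => tnth (f u) (Ordinal iltn))).
    exact: (measurableT_comp (measurable_tnth _) mf).
  apply/funext => u /=; rewrite (tnth_nth (g u)) /= nth_rcons size_tuple iltn.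
  by rewrite (tnth_nth (g u)).
rewrite (_ : _ \o _ = g)//; apply/funext => u /=.
have ni : (i : nat) = n by apply/eqP; rewrite eqn_leq nlei andbT -ltnS.
by rewrite (tnth_nth (g u)) /= nth_rcons size_tuple ni ltnn eqxx.
Qed.

Section measurable_transmission.
Context {R : realType} {d} {U : measurableType d}.
Context {k n M : nat} (c : @block_code R k n M) (m : 'I_M).
Variables (H : U -> 'I_k -> 'I_k -> nat -> R[i]) (Z : U -> 'I_k -> nat -> R[i]).

Lemma measurable_input t (y : U -> 'I_k -> t.-tuple R[i]) i :
  (forall j, measurable_fun setT (fun u => y u j)) ->
  measurable_fun setT (fun u => input c m (y u) i).
Proof.
move=> my; rewrite /input; case: is_source; first exact: measurable_cst.
exact: (measurableT_comp (@relay_measurable _ _ _ _ c i t) (my i)).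
Qed.

(** The received symbol without its noise. *)
Definition signal (h : 'I_k -> 'I_k -> nat -> R[i]) (z : 'I_k -> nat -> R[i])
    (j : 'I_k) (t : nat) : R[i] :=
  \sum_(i < k) h i j t * transmitted c m h z i t.

(** The domain [U] is arbitrary and only times before [t] are constrained, so that [U] can be the
    sample space equipped with the sigma-algebra of the past. *)
Lemma measurable_received t :
  (forall i j s, (s < t)%N -> measurable_fun setT (fun u => H u i j s)) ->
  (forall j s, (s < t)%N -> measurable_fun setT (fun u => Z u j s)) ->
  forall j, measurable_fun setT (fun u => received c m (H u) (Z u) t j).
Proof.
elim: t => [|t IH] mH mZ j; first exact: measurable_cst.
have IH' := IH (fun i j s st => mH i j s (leqW st)) (fun j s st => mZ j s (leqW st)).
apply: measurable_rcons; first exact: IH'.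
apply: measurable_complexD; last exact: mZ.
apply: measurable_complex_sum => i; apply: measurable_complexM; first exact: mH.
exact: measurable_input.
Qed.

Lemma measurable_transmitted t :
  (forall i j s, (s < t)%N -> measurable_fun setT (fun u => H u i j s)) ->
  (forall j s, (s < t)%N -> measurable_fun setT (fun u => Z u j s)) ->
  forall i, measurable_fun setT (fun u => transmitted c m (H u) (Z u) i t).
Proof. by move=> mH mZ i; apply: measurable_input; exact: measurable_received. Qed.

(** The asymmetry between [s <= t] for the fading and [s < t] for the noise is causality: the signal
    at time [t] does not involve the noise of that time. *)
Lemma measurable_signal t :
  (forall i j s, (s <= t)%N -> measurable_fun setT (fun u => H u i j s)) ->
  (forall j s, (s < t)%N -> measurable_fun setT (fun u => Z u j s)) ->
  forall j, measurable_fun setT (fun u => signal (H u) (Z u) j t).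
Proof.
move=> mH mZ j; apply: measurable_complex_sum => i.
apply: measurable_complexM; first exact: mH.
by apply: measurable_transmitted => // a b s /ltnW; exact: mH.
Qed.

End measurable_transmission.

(** * Complex Gaussian noise and averages over it *)

Section complex_gaussian.
Context {R : realType} {d} {T : measurableType d} (P : probability T R).
Variables (N0 : R) (N0_gt0 : 0 < N0) (Z : {RV P >-> R[i]}).
Hypothesis Z_law : forall B, measurable B -> distribution P Z B = complex_normal N0 B.
Local Open Scope ereal_scope.
Let N := normal_prob (0 : R) (Num.sqrt (N0 / 2)).
Let mk (p : measurableTypeR R * measurableTypeR R) : R[i] := (p.1 +i* p.2)%C.

Let mmk : measurable_fun setT mk.
Proof. by apply: measurable_fun_complex; [exact: measurable_fst|exact: measurable_snd]. Qed.

Lemma ge0_integral_complex_normal (phi : R[i] -> \bar R) :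
  measurable_fun setT phi -> (forall z, 0 <= phi z) ->
  \int[P]_w phi (Z w) = \int[N \x N]_p phi (p.1 +i* p.2)%C.
Proof.
move=> mphi phi0.
rewrite -(ge0_integral_distribution Z mphi phi0).
pose mk' : {mfun (measurableTypeR R * measurableTypeR R)%type >-> R[i]} :=
  HB.pack mk (isMeasurableFun.Build _ _ _ _ _ mmk).
transitivity (\int[pushforward (N \x N) mk']_z phi z).
  by apply: eq_measure_integral => A mA _; exact: Z_law.
by rewrite ge0_integral_pushforward.
Qed.

(** Each real coordinate has variance [N0 / 2], so the denominator [sigma ^+ 2 *+ 2] of the
    divergence is [N0]. *)
Lemma le_integral_ln_complex_normal_shift (K : R) (f : R[i] -> R) (s : R[i]) :
  measurable_fun setT f -> (forall z, (1 <= f z <= K)%R) ->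
  \int[P]_w (ln (f (s + Z w)%R))%:E <= (ln (\int[P]_w f (Z w))%R + abs2 s / N0)%R%:E.
Proof.
move=> mf f1K.
rewrite (ge0_integral_complex_normal (phi := fun z => (ln (f (s + z)%R))%:E)); last 2 first.
- apply/measurable_EFinP; apply: (measurableT_comp (@measurable_ln R)).
  apply: (measurableT_comp mf); apply: measurable_complexD; [exact: measurable_cst|exact: measurable_id].
- by move=> z; rewrite lee_fin ln_ge0//; have /andP[] := f1K (s + z)%R.
rewrite [X in ln X](_ : _ = fine (\int[N \x N]_p (f (mk p))%:E)); last first.
  rewrite /Rintegral; congr fine.
  rewrite (ge0_integral_complex_normal (phi := fun z => (f z)%:E))//.
    exact/measurable_EFinP.
  by move=> z; rewrite lee_fin (le_trans ler01)//; have /andP[] := f1K z.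
have N2 : (0 < N0 / 2)%R by rewrite divr_gt0.
have s0 : (Num.sqrt (N0 / 2) != 0)%R by rewrite gt_eqF// sqrtr_gt0.
have := @le_integral_ln_normal_shift2 R _ s0 K (f \o mk) (measurableT_comp mf mmk)
  (fun p => f1K (mk p)) (complex.Re s) (complex.Im s).
rewrite sqr_sqrtr; last exact: ltW.
rewrite -(mulr_natr (N0 / 2)%R) divfK ?pnatr_eq0//; apply: le_trans.
rewrite le_eqVlt; apply/orP; left; apply/eqP.
apply: eq_integral => p _ /=; congr (ln (f _))%:E; rewrite /mk /=.
by case: (s) => a b /=; rewrite (addrC p.1) (addrC p.2).
Qed.

End complex_gaussian.

Section noise_average.
Context {R : realType} {d} {T : measurableType d} (P : probability T R).
Variable (Z : nat -> {RV P >-> R[i]}).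

(** The conditional mean of [f] given its first [n] arguments when the word is pure noise. *)
Definition noise_step n (f : n.+1.-tuple R[i] -> R) (y : n.-tuple R[i]) : R :=
  \int[P]_w f [tuple of rcons y (Z n w)].

(* The mean of f (Z 0, ..., Z (n - 1)) for independent Z 0, ..., Z (n - 1). *)
Fixpoint noise_avg n : (n.-tuple R[i] -> R) -> R :=
  match n with
  | 0 => fun f => f [tuple]
  | n'.+1 => fun f => noise_avg (@noise_step n' f)
  end.

Section step.
Context (n : nat) (f : n.+1.-tuple R[i] -> R).
Hypothesis mf : measurable_fun setT f.

Lemma measurable_noise_section (y : n.-tuple R[i]) :
  measurable_fun setT (fun w => f [tuple of rcons y (Z n w)]).
Proof.
by apply: (measurableT_comp mf); apply: measurable_rcons => //; exact: measurable_cst.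
Qed.

Lemma integrable_noise_section K (y : n.-tuple R[i]) : (forall x, `|f x| <= K) ->
  P.-integrable setT (EFin \o (fun w => f [tuple of rcons y (Z n w)])).
Proof.
by move=> fK; apply: (@prob_bounded_integrable _ _ _ P _ K) => //; exact: measurable_noise_section.
Qed.

Lemma noise_step_bounds a b (y : n.-tuple R[i]) : (forall x, a <= f x <= b) ->
  a <= noise_step f y <= b.
Proof.
move=> fab.
have fi : P.-integrable setT (EFin \o (fun w => f [tuple of rcons y (Z n w)])).
  apply: (integrable_noise_section (K := Num.max `|a| `|b|)) => x.
  have /andP[h1 h2] := fab x; rewrite ler_norml !le_max.
  rewrite lerNl le_max; have := ler_norm b; have := ler_norm (- a); rewrite normrN => ? ?.
  by apply/andP; split; [apply/orP; left|apply/orP; right]; lra.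
exact: Rintegral_prob_bounds.
Qed.

Lemma measurable_noise_step K : (forall x, 0 <= f x <= K) -> measurable_fun setT (noise_step f).
Proof.
move=> f0K; apply/measurable_EFinP.
rewrite (_ : EFin \o _ = fubini_F P
    (fun p : n.-tuple R[i] * T => (f [tuple of rcons p.1 (Z n p.2)])%:E)).
  apply: measurable_fun_fubini_tonelli_F => /=.
    apply/measurable_EFinP; apply: (measurableT_comp mf).
    apply: measurable_rcons; first exact: measurable_fst.
    exact: (measurableT_comp (measurable_funPT (Z n)) measurable_snd).
  by move=> p; rewrite lee_fin; have /andP[] := f0K [tuple of rcons p.1 (Z n p.2)].
apply/funext => y; rewrite /= /noise_step /fubini_F EFin_Rintegral//.
by apply: (integrable_noise_section (K := K)) => x; have /andP[? ?] := f0K x; rewrite ger0_norm.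
Qed.

End step.

Lemma noise_avg_cst (n : nat) (r : R) : @noise_avg n (fun=> r) = r.
Proof.
elim: n => [//|n IH] /=; rewrite -[RHS]IH; congr noise_avg.
by apply/funext => y; rewrite /noise_step Rintegral_prob_cst.
Qed.

Lemma noise_avg_sum (n : nat) (I : Type) (s : seq I) (K : R) (F : I -> n.-tuple R[i] -> R) :
  (forall i, measurable_fun setT (F i)) -> (forall i x, 0 <= F i x <= K) ->
  noise_avg (fun y => \sum_(i <- s) F i y) = \sum_(i <- s) noise_avg (F i).
Proof.
elim: n F => [//|n IH] F mF F0K /=.
rewrite -IH; last 2 first.
- by move=> i; exact: (measurable_noise_step (mF i) (F0K i)).
- by move=> i x; exact: noise_step_bounds.
congr noise_avg; apply/funext => y.
have Fi i : P.-integrable setT (EFin \o (fun w => F i [tuple of rcons y (Z n w)])).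
  have FK x : `|F i x| <= K by have /andP[? ?] := F0K i x; rewrite ger0_norm.
  exact: (integrable_noise_section (mF i) y FK).
rewrite /noise_step; elim: s {IH} => [|i s IHs].
  under eq_Rintegral do rewrite big_nil.
  by rewrite big_nil Rintegral_prob_cst.
under eq_Rintegral do rewrite big_cons.
rewrite RintegralD// ?IHs ?big_cons//.
elim: s {IHs} => [|j s IHs].
  under eq_fun do rewrite big_nil.
  by apply: (@prob_bounded_integrable _ _ _ P (cst 0) 0) => [|x]; rewrite ?normr0.
under eq_fun do rewrite big_cons.
by apply: eq_integrable (integrableD measurableT (Fi j) IHs).
Qed.

End noise_average.

(** * Second moments of sums of pairwise independent symmetric variables *)

Section uncorrelated_sum.
Context {R : realType} {d} {T : measurableType d} (P : probability T R).

(** The inner product of C seen as R^2, that is, the real part of [u] times the conjugate of [v]. *)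
Definition rdot (u v : R[i]) : R :=
  complex.Re u * complex.Re v + complex.Im u * complex.Im v.

Lemma abs2D (u v : R[i]) : abs2 (u + v) = abs2 u + abs2 v + 2 * rdot u v.
Proof. by case: u v => [a b] [a' b']; rewrite /abs2 /rdot /=; ring. Qed.

Lemma abs2N (u : R[i]) : abs2 (- u) = abs2 u.
Proof. by case: u => [a b]; rewrite /abs2 /= !sqrrN. Qed.

Lemma abs2M (u v : R[i]) : abs2 (u * v) = abs2 u * abs2 v.
Proof. by case: u v => [a b] [a' b']; rewrite /abs2 /=; ring. Qed.

Lemma abs2_ge0 (u : R[i]) : 0 <= abs2 u.
Proof. by rewrite addr_ge0 ?sqr_ge0. Qed.

Lemma rdotNl (u v : R[i]) : rdot (- u) v = - rdot u v.
Proof. by case: u v => [a b] [a' b']; rewrite /rdot /=; ring. Qed.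

Lemma rdot_sumr (I : Type) (s : seq I) (u : R[i]) (v : I -> R[i]) :
  rdot u (\sum_(i <- s) v i) = \sum_(i <- s) rdot u (v i).
Proof.
elim: s => [|i s IH]; first by rewrite !big_nil /rdot /= !mulr0 addr0.
rewrite !big_cons -IH; case: (v i) (\sum_(j <- s) v j) => [a b] [a' b'].
by rewrite /rdot /=; ring.
Qed.

Lemma rdot_le (u v : R[i]) : `|rdot u v| <= abs2 u + abs2 v.
Proof.
have := abs2_ge0 (u + v); have := abs2_ge0 (- u + v).
rewrite !abs2D abs2N rdotNl => h1 h2; have := abs2_ge0 u; have := abs2_ge0 v.
by rewrite ler_norml => *; apply/andP; split; lra.
Qed.

Lemma measurable_rdot (f g : T -> R[i]) : measurable_fun setT f ->
  measurable_fun setT g -> measurable_fun setT (fun w => rdot (f w) (g w)).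
Proof.
move=> mf mg; apply: measurable_funD; apply: measurable_funM.
- exact: (measurableT_comp measurable_Re mf).
- exact: (measurableT_comp measurable_Re mg).
- exact: (measurableT_comp measurable_Im mf).
- exact: (measurableT_comp measurable_Im mg).
Qed.

Lemma integrable_rdot (f g : T -> R[i]) : measurable_fun setT f ->
  measurable_fun setT g ->
  P.-integrable setT (EFin \o (fun w => abs2 (f w))) ->
  P.-integrable setT (EFin \o (fun w => abs2 (g w))) ->
  P.-integrable setT (EFin \o (fun w => rdot (f w) (g w))).
Proof.
move=> mf mg fi gi; apply: (le_integrable measurableT _ _ (integrableD measurableT fi gi)).
  by apply/measurable_EFinP; exact: measurable_rdot.
move=> w _ /=; rewrite lee_fin [X in _ <= X]ger0_norm; last by rewrite addr_ge0 ?abs2_ge0.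
exact: rdot_le.
Qed.

Variables (I : eqType) (h : I -> {RV P >-> R[i]}) (gamma : I -> R).
Hypothesis h_sym : forall i B, measurable B ->
  P [set w | B (- h i w)] = distribution P (h i) B.
Hypothesis h_gamma : forall i,
  (\int[P]_w (abs2 (h i w))%:E = (gamma i)%:E)%E.
Hypothesis h_pairs : forall i l, i != l -> forall B B',
  measurable B -> measurable B' ->
  P (h i @^-1` B `&` h l @^-1` B') = (P (h i @^-1` B) * P (h l @^-1` B'))%E.
Variable x : I -> R[i].

Let u i w := h i w * x i.

Let mu i : measurable_fun setT (u i).
Proof. by apply: measurable_complexM => //; exact: measurable_cst. Qed.

Let hi i : P.-integrable setT (EFin \o (fun w => abs2 (h i w))).
Proof.
apply/integrableP; split; first by apply/measurable_EFinP; exact: measurable_abs2.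
under eq_integral do rewrite /= ger0_norm ?abs2_ge0//.
by rewrite h_gamma ltry.
Qed.

Let uE i : (fun w => abs2 (u i w)) = (fun w => abs2 (x i) * abs2 (h i w)).
Proof. by apply/funext => w; rewrite /u abs2M mulrC. Qed.

Let ui i : P.-integrable setT (EFin \o (fun w => abs2 (u i w))).
Proof. by rewrite uE; apply: eq_integrable (integrableZl measurableT (abs2 (x i)) (hi i)). Qed.

Let ge0_integral_sym i (phi : R[i] -> \bar R) : measurable_fun setT phi ->
  (forall z, 0 <= phi z)%E ->
  (\int[P]_w phi (h i w) = \int[P]_w phi (- h i w)%R)%E.
Proof.
move=> mphi phi0.
have mN : measurable_fun setT (fun w => - h i w).
  rewrite (_ : (fun w => _) = (fun w => (- 1) * h i w)).
    by apply: measurable_complexM => //; exact: measurable_cst.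
  by apply/funext => w; rewrite mulN1r.
pose N : {mfun T >-> R[i]} := HB.pack (fun w => - h i w)
  (isMeasurableFun.Build _ _ _ _ _ mN).
transitivity (\int[distribution P (h i)]_z phi z)%E.
  by rewrite ge0_integral_distribution.
transitivity (\int[distribution P N]_z phi z)%E; last first.
  by rewrite ge0_integral_distribution.
by apply: eq_measure_integral => B mB _; exact/esym/h_sym.
Qed.

(* h i and - h i have the same law and are independent of h l. *)
Let rdot0 i l : i != l -> \int[P]_w rdot (u i w) (u l w) = 0.
Proof.
move=> il.
have key (e : R[i]) : measurable_fun setT (fun p : R[i] * R[i] => (abs2 (e * p.2 * x i + p.1 * x l))%:E).
  apply/measurable_EFinP; apply: measurable_abs2; apply: measurable_complexD.
    apply: measurable_complexM; last exact: measurable_cst.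
    by apply: measurable_complexM; [exact: measurable_cst|exact: measurable_snd].
  by apply: measurable_complexM; [exact: measurable_fst|exact: measurable_cst].
have pos (e : R[i]) (p : R[i] * R[i]) : (0 <= (abs2 (e * p.2 * x i + p.1 * x l))%:E)%E.
  by rewrite lee_fin abs2_ge0.
have ind B B' : measurable B -> measurable B' ->
    P (h l @^-1` B `&` h i @^-1` B') = (P (h l @^-1` B) * P (h i @^-1` B'))%E.
  by apply: h_pairs; rewrite eq_sym.
(* Changing the sign of [h i] preserves the mean of the squared modulus, whereas by polarization it
   changes the sign of the [rdot] term. The pair is ordered as [(h l, h i)] so that [h i] is
   integrated first. *)
have E : (\int[P]_w (abs2 (u i w + u l w))%:E = \int[P]_w (abs2 (- u i w + u l w))%:E)%E.
  transitivity (\int[P]_w (abs2 (1 * h i w * x i + h l w * x l))%:E)%E.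
    by apply: eq_integral => w _; rewrite mul1r.
  rewrite (indep_fubini (measurable_funPT (h l)) (measurable_funPT (h i)) ind (key 1) (pos 1)).
  transitivity (\int[P]_w (abs2 (-1 * h i w * x i + h l w * x l))%:E)%E; last first.
    by apply: eq_integral => w _; rewrite mulN1r mulNr.
  rewrite (indep_fubini (measurable_funPT (h l)) (measurable_funPT (h i)) ind (key (-1)) (pos (-1))).
  apply: eq_integral => w _ /=.
  rewrite (ge0_integral_sym i (phi := fun z => (abs2 (1 * z * x i + h l w * x l))%:E)).
  - by apply: eq_integral => w' _; rewrite mul1r mulN1r.
  - exact: (measurableT_comp (key 1) (pair1_measurable (h l w))).
  - by move=> z; exact: (pos 1 (h l w, z)).
have ri := integrable_rdot (mu i) (mu l) (ui i) (ui l).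
have r2i (e : R) : P.-integrable setT (EFin \o (fun w => e * rdot (u i w) (u l w))).
  by apply: eq_integrable (integrableZl measurableT e ri).
have uui : P.-integrable setT (EFin \o (fun w => abs2 (u i w) + abs2 (u l w))).
  by apply: eq_integrable (integrableD measurableT (ui i) (ui l)).
have {}E := congr1 fine E.
have E1 : \int[P]_w (abs2 (u i w) + abs2 (u l w) + 2 * rdot (u i w) (u l w)) =
    \int[P]_w (abs2 (u i w) + abs2 (u l w) + (- 2) * rdot (u i w) (u l w)).
  move: E; rewrite -!/(Rintegral P setT _) => E; etransitivity; last etransitivity; last 2 first.
  - exact: E.
  - by apply: eq_Rintegral => w _; rewrite abs2D abs2N rdotNl mulrN mulNr.
  - by apply: eq_Rintegral => w _; rewrite abs2D.
rewrite RintegralD// [in RHS]RintegralD// !RintegralZl// in E1.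
by lra.
Qed.

(** Only two coefficients occur in each cross term, so pairwise independence makes all cross terms
    vanish. *)
Lemma integral_abs2_sum (s : seq I) : uniq s ->
  (\int[P]_w (abs2 (\sum_(i <- s) h i w * x i))%:E =
   (\sum_(i <- s) gamma i * abs2 (x i))%:E)%E.
Proof.
move=> us.
suff [si sE] : P.-integrable setT (EFin \o (fun w => abs2 (\sum_(i <- s) u i w))) /\
    \int[P]_w abs2 (\sum_(i <- s) u i w) = \sum_(i <- s) gamma i * abs2 (x i).
  by rewrite -sE EFin_Rintegral.
elim: s us => [_|i s IH /= /andP[is_ us]].
  rewrite big_nil; under eq_fun do rewrite big_nil.
  have -> : abs2 (0 : R[i]) = 0 by rewrite /abs2 /= expr0n addr0.
  rewrite Rintegral_prob_cst; split => //.
  by apply: (@prob_bounded_integrable _ _ _ P (cst 0) 0) => [|y]; rewrite ?normr0.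
have [si sE] := IH us.
have rE : (fun w => rdot (u i w) (\sum_(l <- s) u l w)) = (fun w => \sum_(l <- s) rdot (u i w) (u l w)).
  by apply/funext => w; rewrite rdot_sumr.
have [ri r0] : P.-integrable setT (EFin \o (fun w => \sum_(l <- s) rdot (u i w) (u l w))) /\
    \int[P]_w (\sum_(l <- s) rdot (u i w) (u l w)) = 0.
  elim: s is_ {us IH si sE rE} => [_|l s IH].
    under eq_fun do rewrite big_nil.
    rewrite Rintegral_prob_cst; split => //.
    by apply: (@prob_bounded_integrable _ _ _ P (cst 0) 0) => [|y]; rewrite ?normr0.
  rewrite in_cons negb_or => /andP[il /IH[IHi IH0]].
  have rli := integrable_rdot (mu i) (mu l) (ui i) (ui l).
  under eq_fun do rewrite big_cons.
  split; last by rewrite RintegralD// rdot0// IH0 addr0.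
  by apply: eq_integrable (integrableD measurableT rli IHi).
have r2i : P.-integrable setT (EFin \o (fun w => 2 * \sum_(l <- s) rdot (u i w) (u l w))).
  by apply: eq_integrable (integrableZl measurableT 2 ri).
have usi : P.-integrable setT (EFin \o (fun w => abs2 (u i w) + abs2 (\sum_(l <- s) u l w))).
  by apply: eq_integrable (integrableD measurableT (ui i) si).
have E w : abs2 (\sum_(l <- i :: s) u l w) =
    abs2 (u i w) + abs2 (\sum_(l <- s) u l w) + 2 * \sum_(l <- s) rdot (u i w) (u l w).
  by rewrite big_cons abs2D rdot_sumr.
under eq_fun do rewrite E.
split; first by apply: eq_integrable (integrableD measurableT usi r2i).
rewrite RintegralD// RintegralD// RintegralZl// r0 mulr0 addr0 sE big_cons; congr (_ + _).
rewrite [X in Rintegral _ _ X]uE RintegralZl// mulrC; congr (_ * _).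
by rewrite /Rintegral h_gamma.
Qed.

End uncorrelated_sum.

(** * Received information and received energy *)

Section channel_bounds.
Context {R : realType} {k : nat} {d} {T : measurableType d} {P : probability T R}.
Variables (ch : channel k P) (N0 : R) (gain : 'I_k -> 'I_k -> R).
Hypotheses (N0_gt0 : 0 < N0) (model : channel_model ch N0 gain).

Let F (b : nat + 'I_k * nat) : set (set T) :=
  match b with
  | inl t => fading_events ch t
  | inr (j, t) => events_of (noise ch j t)
  end.

Let F_sigma b : sigma_algebra setT (F b).
Proof.
case: b => [t|[j t]] /=; first exact: smallest_sigma_algebra.
by apply: sigma_algebra_preimage; exact: sigma_algebra_measurable.
Qed.

Let events_of_measurable d' (T' : measurableType d') (X : {RV P >-> T'}) :
  events_of X `<=` measurable.
Proof. by move=> _ [B mB <-]; exact: measurable_funPT. Qed.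

Let F_meas b : F b `<=` measurable.
Proof.
case: b => [t|[j t]] /=; last exact: events_of_measurable.
apply: smallest_sub; first exact: sigma_algebra_measurable.
by move=> A [[i j] _]; exact: events_of_measurable.
Qed.

(* The fading up to time ft and the noise up to time nt, both excluded. *)
Let past (ft nt : nat) : pred (nat + 'I_k * nat) := fun b =>
  match b with inl t => (t < ft)%N | inr (_, t) => (t < nt)%N end.

Let pastG ft nt := \bigcup_(b in [set b | past ft nt b]) F b.

Let past_indep ft nt b A B : ~~ past ft nt b -> <<s pastG ft nt >> A -> F b B ->
  P (A `&` B) = (P A * P B)%E.
Proof. exact: (mutually_independent_group F_sigma F_meas (time_noise_indep model)). Qed.

(** The sample space with only the events of the past measurable. The identity [past_id] is then a
    random variable that carries the past, and [past_indep] states independence from it. *)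
Local Notation TG ft nt := (g_sigma_algebraType (pastG ft nt)).

Let past_id ft nt : measurable_fun setT (id : T -> TG ft nt).
Proof.
move=> _ A mA; rewrite setTI; move: A mA.
apply: smallest_sub; first exact: sigma_algebra_measurable.
by move=> A [b _]; exact: F_meas.
Qed.

Let fading_past ft nt t i j : (t < ft)%N ->
  measurable_fun setT (fading ch i j t : TG ft nt -> R[i]).
Proof.
move=> tft _ B mB; apply: sub_sigma_algebra; exists (inl t) => //=.
by apply: sub_sigma_algebra; exists (i, j) => //; exists B.
Qed.

Let noise_past ft nt t j : (t < nt)%N ->
  measurable_fun setT (noise ch j t : TG ft nt -> R[i]).
Proof.
by move=> tnt _ B mB; apply: sub_sigma_algebra; exists (inr (j, t)) => //; exists B.
Qed.

Context {n M : nat} (c : @block_code R k n M) (m : 'I_M).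

Let Y t j w := received c m (fading_at ch w) (noise_at ch w) t j.
Let X i t w := transmitted c m (fading_at ch w) (noise_at ch w) i t.
Let S j t w := signal c m (fading_at ch w) (noise_at ch w) j t.

Lemma measurable_channel_received t j : measurable_fun setT (Y t j).
Proof. by apply: measurable_received => *; exact: measurable_funPT. Qed.

Lemma measurable_channel_transmitted i t : measurable_fun setT (X i t).
Proof. by apply: measurable_transmitted => *; exact: measurable_funPT. Qed.

Lemma measurable_channel_signal j t : measurable_fun setT (S j t).
Proof. by apply: measurable_signal => *; exact: measurable_funPT. Qed.

(** The chain rule. With the past fixed, the last symbol is [noise ch j t] shifted by the constant
    [S j t w]; the one-symbol inequality costs [abs2 (S j t w) / N0] and replaces [f] by
    [noise_step f], which has the same bounds and one argument fewer, so that the induction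
    hypothesis applies to it. *)
Lemma le_integral_ln_received (j : 'I_k) (t : nat) (K : R) (f : t.-tuple R[i] -> R) :
  measurable_fun setT f -> (forall y, 1 <= f y <= K) ->
  (\int[P]_w (ln (f (Y t j w)))%:E <=
   (ln (@noise_avg _ _ _ P (noise ch j) t f))%:E +
   \sum_(s < t) \int[P]_w (abs2 (S j s w) / N0)%:E)%E.
Proof.
elim: t f => [|t IH] f mf f1K.
  rewrite big_ord0 adde0 /Y /=.
  have -> : (fun w => (ln (f [tuple]))%:E) = EFin \o cst (ln (f [tuple])) :> (T -> _) by [].
  by rewrite -(@EFin_Rintegral _ _ _ P (cst (ln (f [tuple])))) ?Rintegral_prob_cst//;
      exact: (@prob_bounded_integrable _ _ _ P _ `|ln (f [tuple])|).
(* In [TG t.+1 t] the fading at time [t] belongs to the past, the noise at time [t] does not. *)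
have mY : measurable_fun setT (fun w : TG t.+1 t => Y t j w).
  by apply: measurable_received => *; [apply: fading_past; exact: leqW|exact: noise_past].
have mS : measurable_fun setT (fun w : TG t.+1 t => S j t w).
  by apply: measurable_signal => *; [exact: fading_past|exact: noise_past].
have f0 y : 0 <= f y <= K by have /andP[h1 h2] := f1K y; rewrite (le_trans ler01).
have fgt0 y : 0 < f y by have /andP[h1 _] := f1K y; exact: lt_le_trans h1.
pose phi (p : TG t.+1 t * R[i]) := (ln (f [tuple of rcons (Y t j p.1) (S j t p.1 + p.2)]))%:E.
have mphi : measurable_fun setT phi.
  apply/measurable_EFinP; apply: (measurableT_comp (@measurable_ln R)).
  apply: (measurableT_comp mf); apply: measurable_rcons.
    exact: (measurableT_comp mY measurable_fst).
  apply: measurable_complexD; last exact: measurable_snd.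
  exact: (measurableT_comp mS measurable_fst).
have phi0 p : (0 <= phi p)%E.
  by rewrite lee_fin ln_ge0//; have /andP[] := f1K [tuple of rcons (Y t j p.1) (S j t p.1 + p.2)].
have -> : (\int[P]_w (ln (f (Y t.+1 j w)))%:E = \int[P]_w phi (w, noise ch j t w))%E by [].
rewrite (indep_fubini (phi := phi) (@past_id t.+1 t) (measurable_funPT (noise ch j t)))//; last first.
  move=> A B mA mB; apply: (@past_indep t.+1 t (inr (j, t))) => //=; first by rewrite ltnn.
  by exists B => //; rewrite setTI.
set g := noise_step (noise ch j) f.
have mg : measurable_fun setT g by exact: (measurable_noise_step (noise ch j) mf f0).
have g1K y : 1 <= g y <= K by exact: (noise_step_bounds (noise ch j) mf y f1K).
have mlng : measurable_fun setT (fun w => (ln (g (Y t j w)))%:E).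
  apply/measurable_EFinP; apply: (measurableT_comp (@measurable_ln R)).
  by apply: (measurableT_comp mg); exact: measurable_channel_received.
have mabs2 : measurable_fun setT (fun w => (abs2 (S j t w) / N0)%:E).
  apply/measurable_EFinP; apply: measurable_funM; last exact: measurable_cst.
  by apply: measurable_abs2; exact: measurable_channel_signal.
apply: (@le_trans _ _ (\int[P]_w ((ln (g (Y t j w)))%:E + (abs2 (S j t w) / N0)%:E))%E).
  apply: ge0_le_integral => //.
  - by move=> w _; apply: integral_ge0 => w' _.
  - have mphi' : measurable_fun setT (fun p : T * T => phi (p.1, noise ch j t p.2)).
      apply: (measurableT_comp mphi); apply: measurable_fun_pair.
        exact: (measurableT_comp (@past_id t.+1 t) measurable_fst).
      exact: (measurableT_comp (measurable_funPT (noise ch j t)) measurable_snd).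
    exact: (measurable_fun_fubini_tonelli_F _ mphi' (fun p => phi0 _)).
  - by apply: emeasurable_funD; [exact: mlng|exact: mabs2].
  - move=> w _; rewrite -EFinD.
    pose fz (z : R[i]) : R := f [tuple of rcons (Y t j w) z].
    have mfz : measurable_fun setT fz.
      by apply: (measurableT_comp mf); apply: measurable_rcons => //; exact: measurable_cst.
    have f1Kz z : 1 <= fz z <= K by exact: f1K.
    exact: (le_integral_ln_complex_normal_shift N0_gt0 (noise_law model j t)
      (S j t w) mfz f1Kz).
rewrite ge0_integralD//; last 2 first.
- by move=> w _; rewrite lee_fin ln_ge0//; have /andP[] := g1K (Y t j w).
- by move=> w _; rewrite lee_fin divr_ge0 ?(ltW N0_gt0)// addr_ge0 ?sqr_ge0.
rewrite big_ord_recr /=; apply: (le_trans (leeD (IH g mg g1K) (lexx _))).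
by rewrite -addeA.
Qed.

(** The diagonal is set to 0 because a node does not hear itself, whereas [gain i i] is left
    arbitrary by the model (for [path_gain] it is [g 0]). *)
Definition cross_gain (i j : 'I_k) : R := if i == j then 0 else gain i j.

Lemma cross_gain_ge0 i j : 0 <= cross_gain i j.
Proof.
rewrite /cross_gain; case: ifPn => // ij.
by rewrite -lee_fin -(fading_gain model 0 ij) integral_ge0// => w _; rewrite lee_fin abs2_ge0.
Qed.

(** Circular symmetry at the angle [pi]; on the diagonal the coefficient is 0. *)
Let fading_neg i j t B : measurable B ->
  P [set w | B (- fading ch i j t w)] = distribution P (fading ch i j t) B.
Proof.
move=> mB; have [->|ij] := eqVneq i j.
  rewrite /distribution /pushforward /=; congr (P _).
  by apply/seteqP; split => w /=; rewrite (fading_diag model) oppr0.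
rewrite -(fading_circular model t pi ij mB); congr (P _).
by apply/seteqP; split => w /=; rewrite cospi sinpi (_ : (-1 +i* 0)%C = -1) ?mulN1r//;
  apply/eqP; rewrite eq_complex /= oppr0 !eqxx.
Qed.

(** The model speaks of coefficients between distinct nodes. The remaining one, from [j] to itself,
    is constantly 0, so its events are empty or full. *)
Let fading_cross j t i l : i != l -> forall B B', measurable B -> measurable B' ->
  P (fading ch i j t @^-1` B `&` fading ch l j t @^-1` B') =
  (P (fading ch i j t @^-1` B) * P (fading ch l j t @^-1` B'))%E.
Proof.
move=> il B B' mB mB'.
have diag C : fading ch j j t @^-1` C = setT \/ fading ch j j t @^-1` C = set0.
  have [C0|C0] := pselect (C 0); [left|right]; apply/seteqP; split => w //=;
    by rewrite (fading_diag model).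
have [ij|ij] := eqVneq i j.
  rewrite ij; have [->|->] := diag B; first by rewrite setTI probability_setT mul1e.
  by rewrite set0I measure0 mul0e.
have [lj|lj] := eqVneq l j.
  rewrite lj; have [->|->] := diag B'; first by rewrite setIT probability_setT mule1.
  by rewrite setI0 measure0 mule0.
by apply: (fading_pairs model) => //; rewrite xpair_eqE negb_and il.
Qed.

Let fading_moment j t i :
  (\int[P]_w (abs2 (fading ch i j t w))%:E = (cross_gain i j)%:E)%E.
Proof.
rewrite /cross_gain; case: eqVneq => [->|ij]; last exact: (fading_gain model).
apply: integral0_eq => w _.
by rewrite (fading_diag model) /abs2 /= expr0n addr0.
Qed.

(** This is where the absence of channel state information enters: the inputs at time [t] are
    functions of the fading and noise before [t], hence independent of the whole fading matrix at
    time [t]. With the inputs fixed, [integral_abs2_sum] applies. *)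
Lemma integral_abs2_signal j t :
  (\int[P]_w (abs2 (S j t w))%:E =
   \sum_(i < k) (cross_gain i j)%:E * \int[P]_w (abs2 (X i t w))%:E)%E.
Proof.
pose TF := g_sigma_algebraType (F (inl t)).
pose phi (p : TG t t * TF) : \bar R :=
  (abs2 (\sum_(i < k) (fading ch i j t p.2 : R[i]) * X i t p.1))%:E.
have TFm B : measurable (B : set TF) -> F (inl t) B.
  by rewrite (measurable_g_measurableTypeE (F_sigma (inl t))).
have idF : measurable_fun setT (id : T -> TF).
  by move=> _ B /TFm mB; rewrite setTI; exact: (F_meas mB).
have mphi : measurable_fun setT phi.
  apply/measurable_EFinP; apply: measurable_abs2; apply: measurable_complex_sum => i.
  apply: measurable_complexM.
    have mf : measurable_fun setT (fading ch i j t : TF -> R[i]).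
      move=> _ B mB; apply: sub_sigma_algebra; apply: sub_sigma_algebra.
      by exists (i, j) => //; exists B.
    exact: (measurableT_comp mf measurable_snd).
  have mX : measurable_fun setT (fun w : TG t t => X i t w).
    by apply: measurable_transmitted => *; [exact: fading_past|exact: noise_past].
  exact: (measurableT_comp mX measurable_fst).
have phi0 p : (0 <= phi p)%E by rewrite lee_fin abs2_ge0.
have ind A B : measurable (A : set (TG t t)) -> measurable (B : set TF) ->
    P (id @^-1` A `&` id @^-1` B) = (P (id @^-1` A) * P (id @^-1` B))%E.
  move=> mA /TFm mB; apply: (@past_indep t t (inl t)) => //=.
  by rewrite ltnn.
transitivity (\int[P]_w phi (w, w))%E; first by [].
rewrite (indep_fubini (@past_id t t) idF ind mphi phi0).
transitivity (\int[P]_w (\sum_(i < k) (cross_gain i j * abs2 (X i t w)))%:E)%E.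
  apply: eq_integral => w _; rewrite /phi /=.
  exact: (integral_abs2_sum (fading_neg ^~ j ^~ t) (fading_moment j t) (@fading_cross j t)
    (fun i => X i t w) (index_enum_uniq _)).
under eq_integral do rewrite -sumEFin.
rewrite ge0_integral_sum//; last 2 first.
- move=> i; apply/measurable_EFinP; apply: measurable_funM; first exact: measurable_cst.
  by apply: measurable_abs2; exact: measurable_channel_transmitted.
- by move=> i w _; rewrite lee_fin mulr_ge0 ?abs2_ge0 ?cross_gain_ge0.
apply: eq_bigr => i _; under eq_integral do rewrite EFinM.
rewrite ge0_integralZl_EFin ?cross_gain_ge0//.
- by move=> w _; rewrite lee_fin abs2_ge0.
- apply/measurable_EFinP; apply: measurable_abs2.
  exact: measurable_channel_transmitted.
Qed.

End channel_bounds.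

(** * Lower bound on the minimum energy per bit *)

Section converse.
Context {R : realType} {k : nat} {d} {T : measurableType d} {P : probability T R}.
Variables (ch : channel k P) (N0 : R) (gain : 'I_k -> 'I_k -> R).
Hypotheses (N0_gt0 : 0 < N0) (model : channel_model ch N0 gain).
Context {n M : nat} (c : @block_code R k n M) (M_gt1 : (1 < M)%N).

Let rcv m w j := received c m (fading_at ch w) (noise_at ch w) n j.

Let error_event m := [set w | exists2 i : 'I_k, ~~ is_source i & decoder c i (rcv m w i) <> m].

Let measurable_decoded m j : measurable [set w | decoder c j (rcv m w j) = m].
Proof.
rewrite -[X in measurable X]setTI.
have mY := measurable_channel_received ch c m j (t := n).
exact: (mY measurableT _ (decoder_measurable c j m)).
Qed.

Let measurable_error_event m : measurable (error_event m).
Proof.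
rewrite (_ : error_event m = \bigcup_(i in [set i : 'I_k | ~~ is_source i])
   ~` [set w | decoder c i (rcv m w i) = m]).
  apply: fin_bigcup_measurable; first exact: finite_finset.
  by move=> i _; apply: measurableC; exact: measurable_decoded.
by apply/seteqP; split=> w [i ? ?]; exists i.
Qed.

Let e m : R := fine (P (error_event m)).

Let M1 : 1 < M%:R :> R. Proof. by rewrite ltr1n. Qed.

(* ln (decode_gain j m y) is ln M if j decodes y as m, and 0 otherwise, while
   the decode_gain j m y sum to 2 M - 1 over m. *)
Let decode_gain j m (y : n.-tuple R[i]) : R :=
  1 + (M%:R - 1) * \1_(decoder c j @^-1` [set m]) y.

Let measurable_decode_gain j m : measurable_fun setT (decode_gain j m).
Proof.
apply: measurable_funD => //; apply: measurable_funM => //.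
by apply: measurable_indic; exact: decoder_measurable.
Qed.

Let decode_gain_bounds j m y : 1 <= decode_gain j m y <= M%:R.
Proof.
by rewrite /decode_gain indicE; case: (_ \in _) => /=; rewrite ?mulr1 ?mulr0;
    have := M1; move=> *; apply/andP; split; lra.
Qed.

Let q j m : R := noise_avg (noise ch j) (decode_gain j m).

Let q_ge1 j m : 1 <= q j m.
Proof.
suff H N (f : N.-tuple R[i] -> R) (a b : R) : measurable_fun setT f -> 0 <= a ->
    (forall y, a <= f y <= b) -> a <= noise_avg (noise ch j) f.
  exact: (H _ _ 1 M%:R).
elim: N f => [|N IH] f mf a0 fab /=; first by have /andP[] := fab [tuple].
apply: IH => // [|y]; last exact: noise_step_bounds.
have f0b x : 0 <= f x <= b by have /andP[h ->] := fab x; rewrite (le_trans a0).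
exact: (measurable_noise_step (noise ch j) mf f0b).
Qed.

(** Each word is decoded as exactly one message, so the [q j m] sum to [2 * M - 1]. Their mean is
    just below 2, and bounding [ln] by its tangent at 2 gives the claim. *)
Let sum_ln_q j : \sum_(m < M) ln (q j m) <= M%:R * ln 2.
Proof.
have sum_q : \sum_(m < M) q j m = 2 * M%:R - 1.
  have dg0 m y : 0 <= decode_gain j m y <= M%:R.
    by have /andP[h ->] := decode_gain_bounds j m y; rewrite (le_trans ler01).
  rewrite /q -(noise_avg_sum (noise ch j) (index_enum 'I_M) (measurable_decode_gain j) dg0).
  rewrite (_ : (fun y => _) = (fun=> 2 * M%:R - 1)) ?noise_avg_cst//.
  apply/funext => y; rewrite /decode_gain big_split /= sumr_const card_ord -big_distrr /=.
  rewrite (bigD1 (decoder c j y)) //= indicE mem_set// big1 ?addr0 ?mulr1.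
    by rewrite -[1 *+ M]/(M%:R : R); ring.
  by move=> m mj; rewrite indicE memNset//= => /esym/eqP; rewrite (negbTE mj).
apply: (@le_trans _ _ (\sum_(m < M) (ln 2 + (q j m / 2 - 1)))).
  apply: ler_sum => m _; have q0 : 0 < q j m by exact: lt_le_trans (q_ge1 j m).
  have := ln_leB1 (x := q j m / 2); rewrite ln_div ?posrE// => /(_ _).
  by rewrite divr_gt0// => /(_ isT); lra.
rewrite big_split /= sumr_const card_ord big_split /= -big_distrl /= sum_q.
rewrite sumr_const card_ord -(mulr_natl (ln 2)) -(mulr_natl (- 1)); lra.
Qed.

Lemma sum_error_le (eps : R) : (error_prob ch c <= eps%:E)%E -> \sum_(m < M) e m <= M%:R * eps.
Proof.
rewrite /error_prob => h.
have M0 : 0 < M%:R :> R by rewrite (lt_trans ltr01).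
rewrite -ler_pdivrMl// -lee_fin; apply: le_trans h.
rewrite EFinM -sumEFin lee_wpmul2l ?lee_fin ?invr_ge0 ?ler0n//.
apply: lee_sum => m _; by rewrite /e fineK ?fin_num_measure.
Qed.

Let D j m := (\sum_(s < n) \int[P]_w
  (abs2 (signal c m (fading_at ch w) (noise_at ch w) j s) / N0)%:E)%E.

(** The mean of [ln (decode_gain j m)] under message [m] is [ln M] times the probability that [j]
    decodes [m], and [j] does so whenever no receiver errs. *)
Lemma ln_decode_gain_le j m : ~~ is_source j ->
  ((ln M%:R * (1 - e m) - ln (q j m))%:E <= D j m)%E.
Proof.
move=> js.
have h := le_integral_ln_received N0_gt0 model c m j
  (measurable_decode_gain j m) (decode_gain_bounds j m).
rewrite EFinB leeBlDl//; apply: le_trans h.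
set A := [set w | decoder c j (rcv m w j) = m].
have mA : measurable A by exact: measurable_decoded.
have lnM0 : 0 <= ln M%:R :> R by rewrite ln_ge0// ltW.
rewrite (_ : \int[P]_w _ = (ln M%:R)%:E * P A)%E; last first.
  have -> : P A = (\int[P]_w (\1_A w)%:E)%E by rewrite integral_indic// setIT.
  rewrite -ge0_integralZl_EFin//; last first.
    by apply/measurable_EFinP; exact: measurable_indic.
  apply: eq_integral => w _; rewrite -EFinM; congr _%:E.
  rewrite /decode_gain !indicE.
  have -> : (received c m (fading_at ch w) (noise_at ch w) n j
    \in decoder c j @^-1` [set m]) = (w \in A).
    by apply/idP/idP; rewrite !inE.
  by case: (_ \in _) => /=; rewrite ?mulr1 ?mulr0 ?addr0 ?ln1// addrC subrK.
rewrite EFinM lee_wpmul2l ?lee_fin//.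
rewrite -[A]setCK probability_setC ?EFinB; last exact: measurableC.
rewrite leeB// /e fineK; last by rewrite fin_num_measure.
apply: le_measure; rewrite ?inE//; first exact: measurableC.
by move=> w Aw; exists j.
Qed.

Let X i t m w := transmitted c m (fading_at ch w) (noise_at ch w) i t.

Let receivers := [pred j : 'I_k | ~~ is_source j].

Let DE j m : D j m = (\sum_(s < n) \sum_(i < k)
  (cross_gain gain i j / N0)%:E * \int[P]_w (abs2 (X i s m w))%:E)%E.
Proof.
apply: eq_bigr => s _.
have N0V : 0 <= N0^-1 by rewrite invr_ge0 ltW.
have mS : measurable_fun setT (fun w => (abs2 (signal c m (fading_at ch w) (noise_at ch w) j s))%:E).
  apply/measurable_EFinP; apply: measurable_abs2; exact: measurable_channel_signal.
have mX i : measurable_fun setT (fun w => (abs2 (X i s m w))%:E).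
  apply/measurable_EFinP; apply: measurable_abs2; exact: measurable_channel_transmitted.
under eq_integral do rewrite mulrC EFinM.
rewrite ge0_integralZl_EFin//; last by move=> w _; rewrite lee_fin abs2_ge0.
rewrite (integral_abs2_signal model) ge0_sume_distrr; last first.
  by move=> i _; rewrite mule_ge0 ?lee_fin ?(cross_gain_ge0 model)//
      integral_ge0// => w _; rewrite lee_fin abs2_ge0.
by apply: eq_bigr => i _; rewrite muleA -EFinM (mulrC N0^-1).
Qed.

Let energyE m : (\int[P]_w (\sum_(i < k) \sum_(s < n) abs2 (X i s m w))%R%:E =
  \sum_(s < n) \sum_(i < k) \int[P]_w (abs2 (X i s m w))%:E)%E.
Proof.
have mX i s : measurable_fun setT (fun w => (abs2 (X i s m w))%:E).
  by apply/measurable_EFinP; apply: measurable_abs2; exact: measurable_channel_transmitted.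
transitivity (\int[P]_w \sum_(s < n) \sum_(i < k) (abs2 (X i s m w))%:E)%E.
  apply: eq_integral => w _; rewrite exchange_big /= -sumEFin.
  by apply: eq_bigr => s _; rewrite sumEFin.
rewrite ge0_integral_sum//.
- apply: eq_bigr => s _; rewrite ge0_integral_sum// => i w _.
  by rewrite lee_fin abs2_ge0.
- by move=> s; apply: emeasurable_sum.
- by move=> s w _; apply: sume_ge0 => i _; rewrite lee_fin abs2_ge0.
Qed.

Lemma code_converse (Etot eps G : R) : 0 <= G ->
  (forall i, \sum_(j in receivers) cross_gain gain i j <= G) ->
  (expected_energy ch c <= Etot%:E)%E -> (error_prob ch c <= eps%:E)%E ->
  #|receivers|%:R * (ln M%:R * (1 - eps) - ln 2) <= G / N0 * Etot.
Proof.
move=> G0 sumG hE heps.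
have M0 : 0 < M%:R :> R by rewrite (lt_trans ltr01).
have lnM0 : 0 <= ln M%:R :> R by rewrite ln_ge0// ltW.
have xge0 i s m : (0 <= \int[P]_w (abs2 (X i s m w))%:E)%E.
  by apply: integral_ge0 => w _; rewrite lee_fin abs2_ge0.
have lower : ((#|receivers|%:R * (M%:R * (ln M%:R * (1 - eps) - ln 2)))%:E <=
    \sum_(j in receivers) \sum_(m < M) D j m)%E.
  apply: (@le_trans _ _ (\sum_(j in receivers) \sum_(m < M)
      (ln M%:R * (1 - e m) - ln (q j m))%:E)%E); last first.
    by apply: lee_sum => j jr; apply: lee_sum => m _; exact: ln_decode_gain_le.
  rewrite (_ : _%:E = \sum_(j in receivers) (M%:R * (ln M%:R * (1 - eps) - ln 2))%:E)%E; last first.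
    by rewrite sumEFin sumr_const mulr_natl.
  apply: lee_sum => j _; rewrite sumEFin lee_fin sumrB -big_distrr /= sumrB sumr_const card_ord.
  have := sum_ln_q j; have := sum_error_le heps => h1 h2.
  have : ln M%:R * (M%:R * (1 - eps)) <= ln M%:R * (M%:R - \sum_(m < M) e m).
    by rewrite ler_wpM2l//; lra.
  by rewrite -[1 *+ M]/(M%:R : R) => h3; lra.
have upper : (\sum_(j in receivers) \sum_(m < M) D j m <=
    (G / N0)%:E * (M%:R%:E * expected_energy ch c))%E.
  rewrite /expected_energy [X in (_ * X)%E]muleA -EFinM divff ?gt_eqF// mul1e.
  rewrite exchange_big /= ge0_sume_distrr; last first.
    move=> m _; apply: integral_ge0 => w _; rewrite lee_fin.
    by do 2 apply: sumr_ge0 => ? _; exact: abs2_ge0.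
  apply: lee_sum => m _; rewrite energyE.
  under eq_bigr do rewrite DE.
  rewrite exchange_big /= ge0_sume_distrr; last by move=> s _; exact: sume_ge0.
  apply: lee_sum => s _; rewrite exchange_big /= ge0_sume_distrr//.
  apply: lee_sum => i _; rewrite -ge0_sume_distrl; last first.
    by move=> j _; rewrite lee_fin divr_ge0 ?(cross_gain_ge0 model)// ltW.
  by rewrite lee_wpmul2r// sumEFin lee_fin -big_distrl /= ler_wpM2r// invr_ge0 ltW.
have GN : 0 <= G / N0 by rewrite divr_ge0// ltW.
have : ((G / N0)%:E * (M%:R%:E * expected_energy ch c) <= (G / N0 * (M%:R * Etot))%:E)%E.
  by rewrite (EFinM (G / N0)) lee_wpmul2l ?lee_fin// (EFinM M%:R) lee_wpmul2l ?lee_fin// ltW.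
move=> /(le_trans (le_trans lower upper)); rewrite lee_fin mulrCA [leRHS]mulrCA.
by rewrite ler_pM2l.
Qed.

End converse.

(** An achievable [Eb] below the bound [L] is refuted by a single code: with an error probability
    small against the gap and enough bits, the term [ln 2] of [code_converse] becomes negligible. *)
Lemma Eb_min_lower_bound {R : realType} {k : nat} {d} {T : measurableType d}
    {P : probability T R} (ch : channel k P) (N0 G : R) (gain : 'I_k -> 'I_k -> R) :
  0 < N0 -> channel_model ch N0 gain -> 0 < G ->
  (forall i, \sum_(j < k | ~~ is_source j && (i != j)) gain i j <= G) ->
  ((ln 2 * N0 * #|[pred j : 'I_k | ~~ is_source j]|%:R / G)%:E <= Eb_min ch)%E.
Proof.
move=> N0_gt0 model G0 sumG; set Kr := #|_|%:R; set L := ln 2 * N0 * Kr / G.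
have ln2 : 0 < ln 2 :> R by rewrite ln_gt0// ltr1n.
have LE (x y : R) : Kr * x <= G / N0 * y -> L * x <= ln 2 * y.
  move=> xy; have -> : L * x = ln 2 * N0 / G * (Kr * x) by rewrite /L; ring.
  have -> : ln 2 * y = ln 2 * N0 / G * (G / N0 * y).
    by field; rewrite !gt_eqF.
  by rewrite ler_wpM2l// divr_ge0 ?mulr_ge0// ltW.
clearbody L; apply: le_ereal_inf_tmp => _ [Eb [Eb0 ach] <-].
move: (Eb : R) Eb0 ach => {}Eb Eb0 ach; rewrite lee_fin leNgt; apply/negP => EbL.
have L0 : 0 < L by exact: le_lt_trans EbL.
(* [delta] and [eps * L] each take a quarter of the gap [L - Eb], so that half of it remains. *)
pose delta := (L - Eb) / 4.
have delta0 : 0 < delta by rewrite divr_gt0// subr_gt0.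
pose eps := (L - Eb) / (4 * L).
have epsL : eps * L = delta by rewrite /eps /delta; field; rewrite gt_eqF.
have LEb0 : 0 < L - Eb by rewrite subr_gt0.
have eps0 : 0 < eps by apply: divr_gt0 => //; apply: mulr_gt0.
have eps1 : eps < 1 by rewrite ltr_pdivrMr ?mulr_gt0//; lra.
have /ach/(_ delta delta0)[E0 codes] : 0 < eps < 1 by rewrite eps0.
(* With energy per bit below [Eb + delta], spending this much forces [ln M] above
   [2 * L / (L - Eb) * ln 2], whereas the remaining half gap will give
   [ln M * ((L - Eb) / 2) < L * ln 2]. *)
pose Etot := Num.max E0 ((Eb + delta) * (2 * L / (L - Eb))).
have E0E : E0 <= Etot by rewrite le_max lexx.
have [n [M [M1 [c [cE ceps]] rate]]] := codes Etot E0E.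
have lnM : 0 < ln M%:R :> R by rewrite ln_gt0// ltr1n.
have sumG' i : \sum_(j in [pred j : 'I_k | ~~ is_source j]) cross_gain gain i j <= G.
  apply: le_trans (sumG i); rewrite big_mkcondr /= le_eqVlt; apply/orP; left; apply/eqP.
  by apply: eq_bigr => j _; rewrite /cross_gain; case: eqVneq.
have := code_converse N0_gt0 model M1 (ltW G0) sumG' cE ceps; rewrite -/Kr => conv.
have EtotM : Etot < (Eb + delta) * ln M%:R / ln 2.
  by move: rate; rewrite ltr_pdivrMr ?divr_gt0// mulrA.
have lnM_le : 2 * L / (L - Eb) * ln 2 < ln M%:R.
  have : (Eb + delta) * (2 * L / (L - Eb)) < (Eb + delta) * ln M%:R / ln 2.
    by apply: le_lt_trans EtotM; rewrite le_max lexx orbT.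
  by rewrite -[ltRHS]mulrA ltr_pM2l ?ltr_wpDl// ltr_pdivlMr.
have {}conv := LE _ _ conv.
have h : L * (ln M%:R * (1 - eps) - ln 2) < (Eb + delta) * ln M%:R.
  by apply: (le_lt_trans conv); move: EtotM; rewrite ltr_pdivlMr// mulrC.
have {}h : ln M%:R * ((L - Eb) / 2) < L * ln 2.
  have E : L * (ln M%:R * (1 - eps) - ln 2) = L * ln M%:R - eps * L * ln M%:R - L * ln 2.
    by ring.
  by move: h; rewrite E epsL /delta; lra.
have LEb : 0 < (L - Eb) / 2 by rewrite divr_gt0// subr_gt0.
have : 2 * L / (L - Eb) * ln 2 * ((L - Eb) / 2) < ln M%:R * ((L - Eb) / 2) by rewrite ltr_pM2r.
have -> : 2 * L / (L - Eb) * ln 2 * ((L - Eb) / 2) = L * ln 2.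
  by field; rewrite gt_eqF// subr_gt0.
by move=> /(lt_trans h); rewrite ltxx.
Qed.

(** * Concentration of cell counts *)

Section counting.
Context {R : realType} {d} {T : measurableType d} (P : probability T R).

Lemma prob_bigsetU (I : Type) (r : seq I) (Q : pred I) (A : I -> set T) :
  (forall i, measurable (A i)) ->
  measurable (\big[setU/set0]_(i <- r | Q i) A i) /\
  (P (\big[setU/set0]_(i <- r | Q i) A i) <= \sum_(i <- r | Q i) P (A i))%E.
Proof.
move=> mA; elim: r => [|i r [mr Pr]].
  by rewrite !big_nil measure0; split; [exact: measurable0|].
rewrite !big_cons; case: ifP => // _; split; first exact: measurableU.
by apply: le_trans (measureU2 P (mA i) mr) _; exact: leeD2l.
Qed.

Definition hits {I : finType} (D : pred I) (x : I -> R * R) (B : set (R * R)) : {set I} :=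
  [set i | D i && `[< B (x i) >]].

Context {I : finType} (D : pred I) (X : I -> {RV P >-> (R * R)%type}).
Hypothesis X_indep : mutually_independent P D (fun i => events_of (X i)).
Variables (B : set (R * R)) (p : R).
Hypotheses (mB : measurable B) (pB : forall i, D i -> P (X i @^-1` B) = p%:E).

Let hitsX w := hits D (X ^~ w) B.

Let side (S : {set I}) (i : I) : set T := X i @^-1` (if i \in S then B else ~` B).

Let mside S i : measurable (side S i).
Proof.
by apply: measurable_funPTI; case: ifP => // _; exact: measurableC.
Qed.

Let hitsE (S : {set I}) : S \subset D ->
  [set w | hitsX w = S] = \bigcap_(i in [set` enum D]) side S i.
Proof.
move=> /fintype.subsetP SD; apply/seteqP; split=> [w <- i|w h].
  rewrite /= mem_enum => Di; rewrite /side /= inE.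
  rewrite unfold_in in Di.
  by rewrite Di /=; case: ifPn => [/asboolP//|/asboolP].
apply/setP => i; rewrite inE; apply/andP/idP => [[Di /asboolP Bi]|iS].
  have /h : [set` enum D] i by rewrite /= mem_enum.
  by rewrite /side /=; case: ifP => // _ /(_ Bi).
have Di := SD _ iS; have /h : [set` enum D] i by rewrite /= mem_enum.
by rewrite /side /= iS; split => //; exact/asboolP.
Qed.

Let measurable_hits (S : {set I}) : measurable [set w | hitsX w = S].
Proof.
have [SD|SD] := boolP (S \subset D).
  rewrite hitsE// bigcap_seq; apply: bigsetI_measurable => i _; exact: mside.
rewrite (_ : [set _ | _] = set0)//; apply/seteqP; split => // w /= E.
by case/negP: SD; rewrite -E; apply/fintype.subsetP => i; rewrite inE => /andP[].
Qed.

(* wt p S is the probability of hitting exactly at S; wt (theta * p) S is its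
   exponential tilting theta ^ #|S| * wt p S, which sums to a product over S. *)
Let wt (a : R) (S : {set I}) : R :=
  \prod_i (if i \in S then (if D i then a else 0) else (if D i then 1 - p else 1)).

Lemma prob_hits (S : {set I}) : S \subset D -> P [set w | hitsX w = S] = (wt p S)%:E.
Proof.
move=> SD; rewrite hitsE// (X_indep (s := enum D)); last 3 first.
- exact: enum_uniq.
- by move=> i; rewrite mem_enum.
- move=> i _; exists (if i \in S then B else ~` B); last by rewrite setTI.
  by case: ifP => // _; exact: measurableC.
rewrite big_enum /= /wt -prodEFin [RHS](bigID D) /= [X in (_ * X)%E]big1 ?mule1; last first.
  move=> i Di; rewrite ifN ?(negbTE Di)//; apply: contra Di => iS.
  exact: (fintype.subsetP SD).
apply: eq_big => // i; rewrite unfold_in => Di; rewrite Di /side; case: ifP => // _; first exact: pB.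
by rewrite preimage_setC probability_setC ?pB//; exact: measurable_funPTI.
Qed.

Hypothesis p01 : 0 <= p <= 1.

Let wt_ge0 a S : 0 <= a -> 0 <= wt a S.
Proof.
move=> a0; apply: prodr_ge0 => i _; have /andP[p0 p1] := p01.
by do 2 case: ifP => // _; rewrite subr_ge0.
Qed.

(** Markov's inequality for [theta ^+ #|hitsX w|], carried out on the finitely many values of the
    hit set: on [Q] the weight [wt p S] is at most [c^-1] times the tilted one, and the tilted
    weights sum to a product over the indices. *)
Lemma chernoff_hits (theta c : R) (Q : pred nat) : 0 < theta -> 0 < c ->
  (forall m, Q m -> c <= theta ^+ m) ->
  measurable [set w | Q #|hitsX w|] /\
  (P [set w | Q #|hitsX w|] <=
   (c^-1 * (1 + p * (theta - 1)) ^+ #|D|)%:E)%E.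
Proof.
move=> th0 c0 Qc.
have E : [set w | Q #|hitsX w|] =
    \big[setU/set0]_(S : {set I} | Q #|S|) [set w | hitsX w = S].
  rewrite -bigcup_seq_cond; apply/seteqP; split=> [w Qw|w [S /= /andP[_ QS] wS]];
    last by rewrite /= wS.
  by exists (hitsX w) => //=; rewrite mem_index_enum.
have [mU PU] := prob_bigsetU (index_enum {set I}) (fun S => Q #|S|) measurable_hits.
rewrite E; split => //; apply: (le_trans PU).
have -> : c^-1 * (1 + p * (theta - 1)) ^+ #|D| = \sum_(S : {set I}) c^-1 * wt (p * theta) S.
  rewrite -mulr_sumr; congr (_ * _).
  transitivity (\prod_(i : I) ((if D i then p * theta else 0) + (if D i then 1 - p else 1))); last first.
    by rewrite bigA_distr; apply: eq_bigl.
  rewrite [RHS](bigID D) /= [X in _ = _ * X]big1 ?mulr1; last first.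
    by move=> i /negbTE ->; rewrite add0r.
  rewrite -prodr_const; apply: eq_big => // i; rewrite unfold_in => Di; rewrite Di; ring.
rewrite -sumEFin big_mkcond /=; apply: lee_sum => S _.
have /andP[p0 p1] := p01.
have ge0 : (0 <= (c^-1 * wt (p * theta) S)%:E)%E.
  by rewrite lee_fin mulr_ge0 ?invr_ge0 ?(ltW c0)// wt_ge0// mulr_ge0// ltW.
case: ifP => // QS; have [SD|SD] := boolP (S \subset D); last first.
  rewrite (_ : [set _ | _] = set0) ?measure0//; apply/seteqP; split => // w /= Ew.
  by case/negP: SD; rewrite -Ew; apply/fintype.subsetP => i; rewrite inE => /andP[].
rewrite prob_hits// lee_fin -ler_pdivrMl ?invr_gt0// invrK.
have -> : wt (p * theta) S = theta ^+ #|S| * wt p S.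
  have -> : theta ^+ #|S| = \prod_(i : I) (if i \in S then theta else 1).
    by rewrite -prodr_const big_mkcond.
  rewrite /wt -big_split /=; apply: eq_bigr => i _.
  by do 2 case: ifP => // _; rewrite ?mulr0 ?mul1r// mulrC.
by rewrite ler_wpM2r ?wt_ge0// Qc.
Qed.

(** The large deviation rate of a Poisson variable of mean 1 at the value [theta]. *)
Definition tail_rate (theta : R) : R := theta * ln theta - theta + 1.

(** Covers both tails: for [theta > 1] the hypotheses say that the mean is at most [mu] and [Q]
    implies a count of at least [theta * mu]; for [theta < 1] the signs of [theta - 1] and
    [ln theta] reverse both. The threshold in [chernoff_hits] is [theta] to the power
    [theta * mu]. *)
Lemma tail_hits (theta mu : R) (Q : pred nat) : 0 < theta ->
  #|D|%:R * p * (theta - 1) <= mu * (theta - 1) ->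
  (forall m, Q m -> theta * mu * ln theta <= m%:R * ln theta) ->
  measurable [set w | Q #|hitsX w|] /\
  (P [set w | Q #|hitsX w|] <= (expR (- (mu * tail_rate theta)))%:E)%E.
Proof.
move=> th0 pmu Qm.
have [|m Qmm|mQ PQ] := @chernoff_hits theta (expR (theta * mu * ln theta)) Q th0.
- exact: expR_gt0.
- rewrite -[X in X ^+ m](lnK (x := theta)) ?posrE// -expRM_natl ler_expR.
  exact: Qm.
split => //; apply: (le_trans PQ); rewrite lee_fin -expRN.
have /andP[p0 p1] := p01.
have h0 : 0 <= 1 + p * (theta - 1) by have := mulr_ge0 p0 (ltW th0); lra.
have h1 : (1 + p * (theta - 1)) ^+ #|D| <= expR (#|D|%:R * (p * (theta - 1))).
  by rewrite expRM_natl lerXn2r ?nnegrE ?expR_ge0// expR_ge1Dx.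
apply: (@le_trans _ _ (expR (- (theta * mu * ln theta)) * expR (#|D|%:R * (p * (theta - 1))))).
  by rewrite ler_wpM2l ?expR_ge0.
rewrite -expRD ler_expR /tail_rate; rewrite -!mulrA in pmu *.
by move: pmu; nra.
Qed.

End counting.

Lemma tail_rate_gt0 {R : realType} (theta : R) : 0 < theta -> theta != 1 -> 0 < tail_rate theta.
Proof.
move=> th0 th1; have lnN0 : ln theta != 0 by rewrite ln_eq0.
have := @expR_gt1Dx R (- ln theta); rewrite oppr_eq0 => /(_ lnN0).
rewrite expRN lnK ?posrE// -(ltr_pM2l th0) mulfV ?gt_eqF// /tail_rate; lra.
Qed.

(** * Total gain towards the receivers *)

(** The absolute difference: subtraction is truncated, so at least one term is 0. *)
Definition ndist (a b : nat) : nat := (a - b) + (b - a).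

Lemma card_ord_le_size L (Q : pred 'I_L) (s : seq nat) :
  (forall a, Q a -> (a : nat) \in s) -> (#|Q| <= size s)%N.
Proof.
move=> Qs; rewrite cardE -(size_map val); apply: uniq_leq_size.
  by rewrite (map_inj_uniq val_inj) enum_uniq.
by move=> _ /mapP[a + ->]; rewrite mem_enum => /Qs.
Qed.

Lemma card_ndist_eq L (a0 m : nat) : (#|[pred a : 'I_L | ndist a a0 == m]| <= 2)%N.
Proof.
apply: (@card_ord_le_size L _ [:: a0 + m; a0 - m]%N) => a /eqP <-.
by rewrite !inE /ndist; lia.
Qed.

Lemma card_ndist_le L (a0 m : nat) : (#|[pred a : 'I_L | (ndist a a0 <= m)%N]| <= m.*2.+1)%N.
Proof.
rewrite -[leqRHS](size_iota (a0 - m)).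
apply: (@card_ord_le_size L _ (iota (a0 - m) m.*2.+1)) => a.
by rewrite mem_iota /= /ndist; lia.
Qed.

Section ring_sum.
Context {L : nat} (a0 b0 : 'I_L).

(** The Chebyshev distance to the cell [(a0, b0)]; its level sets are square rings. *)
Definition cheb (p : 'I_L * 'I_L) : nat := maxn (ndist p.1 a0) (ndist p.2 b0).

Lemma cheb_ltn p : (cheb p < L)%N.
Proof.
have := ltn_ord p.1; have := ltn_ord p.2; have := ltn_ord a0; have := ltn_ord b0.
rewrite /cheb /ndist; lia.
Qed.

Lemma card_cheb0 : (#|[pred p | cheb p == 0%N]| <= 1)%N.
Proof.
rewrite -(card1 (a0, b0)); apply: subset_leq_card; apply/fintype.subsetP => -[a b].
rewrite !inE /cheb /ndist /= => h; apply/eqP; congr pair; apply: val_inj => /=; lia.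
Qed.

(** A ring of radius [m.+1] consists of two full columns of at most [2 * m + 3] cells and two rows,
    without the corners, of at most [2 * m + 1] cells. *)
Lemma card_cheb m : (#|[pred p | cheb p == m.+1]| <= 8 * m.+1)%N.
Proof.
pose A1 : {set 'I_L} := [set a : 'I_L | ndist a a0 == m.+1]%SET;
pose B1 : {set 'I_L} := [set b : 'I_L | (ndist b b0 <= m.+1)%N]%SET.
pose A2 : {set 'I_L} := [set a : 'I_L | (ndist a a0 <= m)%N]%SET;
pose B2 : {set 'I_L} := [set b : 'I_L | ndist b b0 == m.+1]%SET.
have sub : [pred p | cheb p == m.+1] \subset finset.setX A1 B1 :|: finset.setX A2 B2.
  apply/fintype.subsetP => -[a b]; rewrite !inE /cheb /=; lia.
apply: leq_trans (subset_leq_card sub) _; apply: leq_trans (leq_card_setU _ _) _.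
rewrite !cardsX.
have hA1 : (#|A1| <= 2)%N by rewrite cardsE card_ndist_eq.
have hB2 : (#|B2| <= 2)%N by rewrite cardsE card_ndist_eq.
have hB1 : (#|B1| <= m.+1.*2.+1)%N by rewrite cardsE card_ndist_le.
have hA2 : (#|A2| <= m.*2.+1)%N by rewrite cardsE card_ndist_le.
apply: leq_trans (leq_add (leq_mul hA1 hB1) (leq_mul hA2 hB2)) _; lia.
Qed.

Lemma sum_cheb_le {R : realType} (f : nat -> R) : (forall m, 0 <= f m) ->
  \sum_p f (cheb p) <= f 0%N + \sum_(1 <= m < L) (8 * m)%:R * f m.
Proof.
move=> f0; have L0 : (0 < L)%N by exact: leq_ltn_trans (ltn_ord a0).
pose chebI p := Ordinal (cheb_ltn p).
rewrite (partition_big chebI predT)//=.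
have -> : \sum_(m < L) \sum_(p | chebI p == m) f (cheb p) =
    \sum_(0 <= m < L) #|[pred p | cheb p == m]|%:R * f m.
  rewrite big_mkord; apply: eq_bigr => m _.
  rewrite mulr_natl -sumr_const; apply: eq_big => p; first by rewrite inE.
  by move=> /eqP <-.
rewrite [leLHS]big_ltn//; apply: lerD.
  by rewrite -[leRHS]mul1r ler_wpM2r// -[1]/(1%:R) ler_nat card_cheb0.
rewrite big_nat [leRHS]big_nat; apply: ler_sum => -[//|m] _.
by rewrite ler_wpM2r// ler_nat card_cheb.
Qed.

End ring_sum.

Section gain_sum.
Context {R : realType}.

(** Bernoulli's inequality: [1 - 1 / x] to the power [- beta] is at least [1 + beta / x], from
    [ln y <= y - 1] and [1 + z <= expR z]. *)
Lemma powR_telescope (beta x : R) : 0 < beta -> 1 < x ->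
  beta * x `^ (- (beta + 1)) <= (x - 1) `^ (- beta) - x `^ (- beta).
Proof.
move=> b0 x1; have x0 : 0 < x by rewrite (lt_trans ltr01).
have xm0 : 0 < x - 1 by rewrite subr_gt0.
have -> : x `^ (- (beta + 1)) = x `^ (- beta) * x^-1.
  rewrite opprD powRD; last by rewrite (gt_eqF x0) implybT.
  by rewrite powR_inv1// ltW.
have h : x `^ (- beta) * (1 + beta / x) <= (x - 1) `^ (- beta).
  have -> : (x - 1) `^ (- beta) = x `^ (- beta) * ((x - 1) / x) `^ (- beta).
    rewrite -powRM ?ltW//; last by rewrite divr_gt0.
    by rewrite mulrCA divff ?gt_eqF// mulr1.
  rewrite ler_wpM2l ?powR_ge0// /powR gt_eqF ?divr_gt0//.
  apply: le_trans (expR_ge1Dx _).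
  have := @ln_leB1 R ((x - 1) / x); rewrite divr_gt0// => /(_ isT).
  have -> : (x - 1) / x - 1 = - x^-1 by field; rewrite gt_eqF.
  by move=> h; rewrite lerD2l mulNr -mulrN ler_wpM2l ?(ltW b0)// lerNr.
move: h; rewrite mulrDr mulr1 mulrCA; lra.
Qed.

Lemma sum_powR_le (beta : R) (n : nat) : 0 < beta ->
  \sum_(1 <= l < n) l%:R `^ (- (beta + 1)) <= 1 + beta^-1.
Proof.
move=> b0; case: n => [|n]; first by rewrite big_geq// addr_ge0// invr_ge0 ltW.
case: n => [|n]; first by rewrite big_geq// addr_ge0// invr_ge0 ltW.
suff h : \sum_(1 <= l < n.+2) l%:R `^ (- (beta + 1)) <= 1 + beta^-1 - n.+1%:R `^ (- beta) / beta.
  by apply: le_trans h _; rewrite gerBl divr_ge0 ?powR_ge0// ltW.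
elim: n => [|n IH]; first by rewrite big_nat1 !powR1 div1r addrK.
rewrite big_nat_recr//=.
have n1 : 1 < n.+2%:R :> R by rewrite ltr1n.
have := powR_telescope b0 n1; rewrite -[X in X - 1]natr1 addrK => h.
have : n.+2%:R `^ (- (beta + 1)) <= n.+1%:R `^ (- beta) / beta - n.+2%:R `^ (- beta) / beta.
  by rewrite -mulrBl ler_pdivlMr// mulrC.
move: IH; lra.
Qed.

Variables (alpha r0 gbar : R) (g : R -> R).
Hypotheses (alpha_gt2 : 2 < alpha) (r0_gt0 : 0 < r0).
Hypothesis g_loss : path_loss alpha r0 gbar g.

(** Points in cells at Chebyshev distance [m] are at least [(m - 1) * r0] apart. For [m >= 2] this
    is at least [r0], where the power law holds; nearer cells only get the bound [gbar]. *)
Definition cell_gain (m : nat) : R := if (m <= 1)%N then gbar else (m.-1%:R * r0) `^ (- alpha).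

(** The term [9 * gbar] accounts for the cell itself and its 8 neighbours. Ring [l + 1] has at most
    [8 * (l + 1) <= 16 * l] cells of gain at most [l * r0] to the power [- alpha], and the sum of
    [l] to the power [1 - alpha] is at most [1 + 1 / (alpha - 2)]. *)
Definition gain_bound : R := 9 * gbar + 16 * r0 `^ (- alpha) * ((alpha - 1) / (alpha - 2)).

Lemma gbar_ge0 : 0 <= gbar.
Proof. by have [g0 _ _ gb] := g_loss; exact: le_trans (g0 0 (lexx _)) gb. Qed.

Lemma cell_gain_ge0 m : 0 <= cell_gain m.
Proof. by rewrite /cell_gain; case: ifP => _; rewrite ?powR_ge0// gbar_ge0. Qed.

Lemma sum_cell_gain L : cell_gain 0 + \sum_(1 <= m < L) (8 * m)%:R * cell_gain m <= gain_bound.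
Proof.
have gb := gbar_ge0; have a2 := alpha_gt2;
  have ab : 0 <= (alpha - 1) / (alpha - 2) by apply: divr_ge0; lra.
have rest0 : 0 <= 16 * r0 `^ (- alpha) * ((alpha - 1) / (alpha - 2)).
  by rewrite mulr_ge0// mulr_ge0// powR_ge0.
case: L => [|[|L]]; rewrite /gain_bound.
- by rewrite big_geq// addr0 /cell_gain /=; lra.
- by rewrite big_geq// addr0 /cell_gain /=; lra.
rewrite big_ltn// addrA lerD//; first by rewrite /cell_gain /= muln1; lra.
rewrite big_add1 /=.
apply: (@le_trans _ _ (16 * r0 `^ (- alpha) * \sum_(1 <= l < L.+1) l%:R `^ (- ((alpha - 2) + 1)))).
  rewrite big_distrr /= big_nat [leRHS]big_nat; apply: ler_sum => l /andP[l1 _].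
  rewrite /cell_gain ltnNge l1 /= powRM ?ler0n ?(ltW r0_gt0)//.
  have l0 : 0 < l%:R :> R by rewrite ltr0n.
  have -> : l%:R `^ (- (alpha - 2 + 1)) = l%:R * l%:R `^ (- alpha) :> R.
    rewrite -[X in _ = X * _]powRr1 ?(ltW l0)// -powRD; last by rewrite (gt_eqF l0) implybT.
    by congr (_ `^ _); ring.
  have := powR_ge0 (l%:R : R) (- alpha); have := powR_ge0 r0 (- alpha).
  move=> h1 h2; have h3 := mulr_ge0 h2 h1.
  have : (8 * l.+1)%:R <= 16 * l%:R :> R.
    by rewrite -(natrM _ 16) ler_nat; lia.
  move=> /(ler_wpM2r h3); rewrite !mulrA; lra.
rewrite ler_wpM2l ?mulr_ge0 ?powR_ge0//.
have := @sum_powR_le (alpha - 2) L.+1; rewrite subr_gt0 => /(_ alpha_gt2).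
move=> /le_trans; apply; rewrite le_eqVlt; apply/orP; left; apply/eqP.
by field; rewrite subr_eq0 gt_eqF.
Qed.

Definition grid_cell (a b : nat) : set (R * R) :=
  [set p | a%:R * r0 <= p.1 < a.+1%:R * r0 /\ b%:R * r0 <= p.2 < b.+1%:R * r0].

Lemma grid_cell_truncn (p : R * R) : 0 <= p.1 -> 0 <= p.2 ->
  grid_cell (Num.truncn (p.1 / r0)) (Num.truncn (p.2 / r0)) p.
Proof.
move=> p1 p2; split.
  have := truncn_itv (x := p.1 / r0); rewrite divr_ge0 ?(ltW r0_gt0)// => /(_ isT).
  by rewrite ler_pdivlMr// ltr_pdivrMr.
have := truncn_itv (x := p.2 / r0); rewrite divr_ge0 ?(ltW r0_gt0)// => /(_ isT).
by rewrite ler_pdivlMr// ltr_pdivrMr.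
Qed.

Lemma ndist_grid (a b m : nat) (x y : R) :
  a%:R * r0 <= x < a.+1%:R * r0 -> b%:R * r0 <= y < b.+1%:R * r0 ->
  (m <= ndist a b)%N -> (0 < m)%N -> (m.-1%:R * r0) ^+ 2 <= (x - y) ^+ 2.
Proof.
move=> /andP[ax xa] /andP[by_ yb] mab m0.
have m0' : 0 <= m.-1%:R * r0 by rewrite mulr_ge0// ltW.
suff : m.-1%:R * r0 <= `|x - y|.
  by move=> h; rewrite -[leRHS]real_normK ?num_real// lerXn2r// ?nnegrE.
have key (c c' : nat) (u v : R) : c%:R * r0 <= u -> v < c'.+1%:R * r0 -> (c' + m <= c)%N ->
    m.-1%:R * r0 <= u - v.
  move=> cu vc cc; have h : (c'.+1%:R + m.-1%:R) * r0 <= c%:R * r0.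
    by rewrite ler_wpM2r ?(ltW r0_gt0)// -natrD ler_nat; lia.
  by rewrite mulrDl in h; lra.
have [ab|ab] := leqP b a.
  have h := key a b x y ax yb; apply: le_trans (ler_norm _); apply: h; rewrite /ndist in mab; lia.
have h := key b a y x by_ xa; rewrite distrC; apply: le_trans (ler_norm _); apply: h.
by rewrite /ndist in mab; lia.
Qed.

Lemma path_gain_le_cell {k} (pos : 'I_k -> R * R) (i j : 'I_k) (a b a' b' : nat) :
  grid_cell a b (pos i) -> grid_cell a' b' (pos j) ->
  path_gain g pos i j <= cell_gain (maxn (ndist a' a) (ndist b' b)).
Proof.
move=> [i1 i2] [j1 j2]; have [g0 gd gr gb] := g_loss.
rewrite /path_gain /cell_gain; set m := maxn _ _.
have dist0 : 0 <= euclidean_dist (pos i) (pos j) by exact: sqrtr_ge0.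
case: ifPn => [_|m1]; first by apply: le_trans (gd 0 _ (lexx _) dist0) gb.
rewrite -ltnNge in m1; have m0 : 0 <= m.-1%:R * r0 by rewrite mulr_ge0// (ltW r0_gt0).
have mr0 : r0 <= m.-1%:R * r0 by rewrite ler_peMl ?(ltW r0_gt0)// ler1n -ltnS prednK// (leq_trans _ m1).
rewrite -gr//; apply: gd => //.
rewrite -[leLHS](ger0_norm m0) -sqrtr_sqr ler_wsqrtr//.
have m00 : (0 < m)%N by exact: leq_trans m1.
have [h|h] := leqP m (ndist a' a).
  have := ndist_grid j1 i1 h m00; rewrite -[leRHS]sqrrN opprB => /le_trans; apply.
  by rewrite lerDl sqr_ge0.
have h' : (m <= ndist b' b)%N.
  by have := leqnn m; rewrite {2}/m leq_max leqNgt h.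
have := ndist_grid j2 i2 h' m00; rewrite -[leRHS]sqrrN opprB => /le_trans; apply.
by rewrite lerDr sqr_ge0.
Qed.

(** Receivers are grouped by cell: each cell holds at most [t] of them, and the bound on the gain
    into a cell depends only on its distance to the cell of [i]. *)
Lemma gain_sum_le {k} (pos : 'I_k -> R * R) (a t : R) (L : nat) :
  (forall j, 0 <= (pos j).1 <= a /\ 0 <= (pos j).2 <= a) -> (Num.truncn (a / r0) < L)%N ->
  (forall c d, (c < L)%N -> (d < L)%N ->
    #|hits (fun j : 'I_k => ~~ is_source j) pos (grid_cell c d)|%:R <= t) ->
  forall i, \sum_(j < k | ~~ is_source j && (i != j)) path_gain g pos i j <= t * gain_bound.
Proof.
move=> box aL ht i.
have cellL (x : R) : 0 <= x <= a -> (Num.truncn (x / r0) < L)%N.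
  move=> /andP[x0 xa]; apply: leq_ltn_trans aL.
  by apply: le_truncn; rewrite ler_pM2r ?invr_gt0.
pose cell j : 'I_L * 'I_L := (Ordinal (cellL _ (box j).1), Ordinal (cellL _ (box j).2)).
have cellP j : grid_cell (cell j).1 (cell j).2 (pos j).
  by have [/andP[h1 _] /andP[h2 _]] := box j; exact: grid_cell_truncn.
have L0 : (0 < L)%N by exact: leq_ltn_trans aL.
have t0 : 0 <= t by apply: le_trans (ht 0%N 0%N L0 L0).
apply: (@le_trans _ _ (\sum_(j < k | ~~ is_source j) cell_gain (cheb (cell i).1 (cell i).2 (cell j)))).
  rewrite [leLHS]big_mkcondr; apply: ler_sum => j _; case: ifP => _; last exact: cell_gain_ge0.
  exact: path_gain_le_cell.
rewrite (partition_big cell predT)//=.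
apply: le_trans (_ : \sum_p t * cell_gain (cheb (cell i).1 (cell i).2 p) <= _).
  apply: ler_sum => p _.
  rewrite (eq_bigr (fun=> cell_gain (cheb (cell i).1 (cell i).2 p))); last by move=> j /andP[_ /eqP ->].
  rewrite sumr_const -[leLHS]mulr_natl ler_wpM2r ?cell_gain_ge0//.
  apply: le_trans (ht p.1 p.2 (ltn_ord _) (ltn_ord _)).
  rewrite ler_nat; apply: subset_leq_card; apply/fintype.subsetP => j; rewrite !inE => /andP[js /eqP <-].
  by rewrite js; apply/asboolP.
rewrite -mulr_sumr ler_wpM2l//.
exact: le_trans (sum_cheb_le _ _ cell_gain_ge0) (sum_cell_gain L).
Qed.

End gain_sum.

(** * Flooding *)

Section flooding_theory.
Context {R : realType} {k : nat} (N0 : R) (gain : 'I_k -> 'I_k -> R) (S : flood_scheme R).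
Hypothesis gain_ge0 : forall i j, 0 <= gain i j.

Local Notation after := (flood_after N0 gain S).

Lemma flood_informedE t :
  flood_informed (after t) = flood_senders (after t) :|: flood_fresh (after t).
Proof.
elim: t => [|t IH]; first by rewrite /= finset.set0U.
by rewrite /flood_after iterS /= -IH.
Qed.

Lemma flood_sendersS t : flood_senders (after t.+1) = flood_informed (after t).
Proof. by rewrite flood_informedE /flood_after iterS. Qed.

(** A node is fresh only when it first learns the message, and the senders learned it earlier: no
    node transmits twice. *)
Lemma flood_senders_fresh t : ([disjoint flood_senders (after t) & flood_fresh (after t)])%B.
Proof.
case: t => [|t]; first by rewrite -finset.setI_eq0 /= finset.set0I.
rewrite -finset.setI_eq0; apply/eqP/setP => j.
rewrite finset.inE finset.in_set0 flood_sendersS /flood_after iterS /= finset.inE -/(after t).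
by case: (j \in _).
Qed.

Lemma node_Eb_ge0 (i : 'I_k) : 0 <= node_Eb S i.
Proof. by rewrite /node_Eb; case: ifP => _; [exact: flood_Eb1_ge0|exact: flood_Eb2_ge0]. Qed.

Lemma flood_total_Eb_le : flood_total_Eb N0 gain S <= \sum_(i < k) node_Eb S i.
Proof.
suff -> : flood_total_Eb N0 gain S =
    \sum_(i in flood_senders (after (flood_slots S))) node_Eb S i.
  rewrite big_mkcond; apply: ler_sum => i _; case: ifP => // _; exact: node_Eb_ge0.
rewrite /flood_total_Eb; elim: (flood_slots S) => [|t IH].
  by rewrite big_ord0 big_set0.
rewrite flood_sendersS flood_informedE (eq_bigl _ _ (fun i => finset.in_setU i _ _)).
by rewrite bigU /=; [rewrite -IH big_ord_recr|exact: flood_senders_fresh].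
Qed.

Lemma flood_informed_mono t j : j \in flood_informed (after t) -> j \in flood_informed (after t.+1).
Proof. by move=> jt; rewrite /flood_after iterS /= finset.inE -/(after t) jt. Qed.

(** All nodes informed by the end of slot [t] have transmitted by the end of slot [t + 1], and
    received energy grows with the set of senders, so any informed set [C] that suffices on its own
    will do. *)
Lemma flood_informedS t j (C : {set 'I_k}) :
  C \subset flood_informed (after t) ->
  (j \notin C -> N0 * ln 2 < \sum_(i in C) gain i j * node_Eb S i) ->
  j \in flood_informed (after t.+1).
Proof.
move=> /fintype.subsetP Ct recv.
have [jt|jt] := boolP (j \in flood_informed (after t)); first exact: flood_informed_mono.
have jC : j \notin C by apply: contra jt; exact: Ct.
rewrite /flood_after iterS /= !finset.inE -/(after t) (negbTE jt) /= -flood_informedE.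
apply: lt_le_trans (recv jC) _; rewrite /received_Eb [leLHS]big_mkcond [leRHS]big_mkcond /=.
apply: ler_sum => i _; case: ifPn => [iC|_].
  by rewrite (Ct _ iC) /= ifT//; apply: contraNneq jC => <-.
by case: ifP => // _; rewrite mulr_ge0 ?node_Eb_ge0.
Qed.

End flooding_theory.

Section flood_cells.
Context {R : realType} (alpha r0 gbar : R) (g : R -> R).
Hypotheses (r0_gt0 : 0 < r0) (g_loss : path_loss alpha r0 gbar g).

Lemma path_gain_ge0 {k} (pos : 'I_k -> R * R) i j : 0 <= path_gain g pos i j.
Proof. by have [g0 _ _ _] := g_loss; apply: g0; exact: sqrtr_ge0. Qed.

(** Corners are pulled back to [a - s], so that every cell keeps the full area [s ^+ 2] inside the
    square and is hit with the same probability. *)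
Definition cell_corner (a s : R) (c : nat) : R := Num.min (c%:R * s) (a - s).

(* Squares of side s inside [0, a]^2 whose translates by s cover it; the last
   row and column overlap the previous ones. *)
Definition flood_cell (a s : R) (c d : nat) : set (R * R) :=
  [set p | cell_corner a s c <= p.1 <= cell_corner a s c + s /\
           cell_corner a s d <= p.2 <= cell_corner a s d + s].

Lemma flood_cell_truncn (a s : R) (p : R * R) : 0 < s ->
  0 <= p.1 <= a -> 0 <= p.2 <= a ->
  flood_cell a s (Num.truncn (p.1 / s)) (Num.truncn (p.2 / s)) p.
Proof.
move=> s0; suff key (x : R) : 0 <= x <= a ->
    cell_corner a s (Num.truncn (x / s)) <= x <= cell_corner a s (Num.truncn (x / s)) + s.
  by move=> p1 p2; split; exact: key.
move=> /andP[x0 xa]; have := truncn_itv (x := x / s); rewrite divr_ge0 ?(ltW s0)// => /(_ isT).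
rewrite ler_pdivlMr// ltr_pdivrMr// => /andP[h1 h2]; rewrite /cell_corner.
rewrite -natr1 mulrDl mul1r in h2.
by case: (leP (_ * s) (a - s)) => h; apply/andP; split; lra.
Qed.

Lemma cell_cornerB (a s : R) (c : nat) : 0 < s ->
  cell_corner a s c.-1 <= cell_corner a s c <= cell_corner a s c.-1 + s.
Proof.
move=> s0; case: c => [|c]; first by rewrite lexx lerDl ltW.
rewrite /cell_corner /= -natr1 mulrDl mul1r.
case: (leP (c%:R * s + s) (a - s)) => h; case: (leP (c%:R * s) (a - s)) => h';
  by apply/andP; split; lra.
Qed.

(** A square of side [2 * s] has diagonal [r0]. *)
Lemma near_gain {k} (pos : 'I_k -> R * R) i j (s : R) : 8 * s ^+ 2 = r0 ^+ 2 ->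
  `|(pos i).1 - (pos j).1| <= 2 * s -> `|(pos i).2 - (pos j).2| <= 2 * s ->
  r0 `^ (- alpha) <= path_gain g pos i j.
Proof.
move=> sr h1 h2; have [g0 gd gr gb] := g_loss.
rewrite -gr//; apply: gd; first exact: sqrtr_ge0.
rewrite -[leRHS](ger0_norm (ltW r0_gt0)) -sqrtr_sqr ler_wsqrtr// -sr.
have sq (x : R) : `|x| <= 2 * s -> x ^+ 2 <= 4 * s ^+ 2.
  move=> hx; rewrite -[leLHS]real_normK ?num_real//.
  have -> : 4 * s ^+ 2 = (2 * s) ^+ 2 by ring.
  by rewrite lerXn2r// nnegrE// (le_trans _ hx).
by have := sq _ h1; have := sq _ h2; lra.
Qed.

Local Notation receiver := (fun j => ~~ is_source j).

(** The message advances one cell per slot in both directions: cells with both indices at most [t]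
    are informed by the end of slot [t + 1], each by its diagonal predecessor and the corner cell by
    the source. *)
Lemma flood_cells_deliver {k} (pos : 'I_k -> R * R) (N0 a s : R) (S : flood_scheme R) :
  0 < s -> 8 * s ^+ 2 = r0 ^+ 2 -> s <= a ->
  (forall j, is_source j -> pos j = (0, 0)) ->
  (exists j : 'I_k, is_source j) ->
  (forall j, 0 <= (pos j).1 <= a /\ 0 <= (pos j).2 <= a) ->
  (Num.truncn (a / s) < flood_slots S)%N ->
  N0 * ln 2 < r0 `^ (- alpha) * flood_Eb1 S ->
  (forall c d, (c < flood_slots S)%N -> (d < flood_slots S)%N ->
    N0 * ln 2 < #|hits receiver pos (flood_cell a s c d)|%:R *
      (r0 `^ (- alpha) * flood_Eb2 S)) ->
  flood_delivers N0 (path_gain g pos) S.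
Proof.
move=> s0 sr sa src [j0 j0src] box aT Eb1 cells.
pose cell c d := hits receiver pos (flood_cell a s c d).
have gge0 := path_gain_ge0 pos.
have corner0 : cell_corner a s 0 = 0.
  by rewrite /cell_corner mul0r; case: (leP 0 (a - s)) => //; lra.
have inf_src t j : is_source j -> j \in flood_informed (flood_after N0 (path_gain g pos) S t).
  move=> js; elim: t => [|t IH]; last exact: flood_informed_mono.
  by rewrite /= finset.inE.
have informed t c d j : (c <= t)%N -> (d <= t)%N -> (t < flood_slots S)%N -> j \in cell c d ->
    j \in flood_informed (flood_after N0 (path_gain g pos) S t.+1).
  elim: t c d j => [|t IH] c d j ct dt tT.
    move: ct dt; rewrite !leqn0 => /eqP -> /eqP ->.
    rewrite finset.inE => /andP[jr /asboolP[/andP[x1 x2] /andP[y1 y2]]].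
    apply: (flood_informedS gge0 (C := [set j0]%SET)).
      by apply/fintype.subsetP => i; rewrite finset.inE => /eqP ->; exact: inf_src.
    move=> _; rewrite big_set1 /node_Eb j0src; apply: lt_le_trans Eb1 _.
    rewrite ler_wpM2r ?flood_Eb1_ge0//; apply: (near_gain sr).
      rewrite corner0 in x1 x2; rewrite src// sub0r normrN ger0_norm//; lra.
    rewrite corner0 in y1 y2; rewrite src// sub0r normrN ger0_norm//; lra.
  rewrite finset.inE => /andP[jr /asboolP[/andP[x1 x2] /andP[y1 y2]]].
  (* The predecessor of 0 is 0, so along the border the message advances within the first row or
     column. *)
  have ct' : (c.-1 <= t)%N by case: (c) ct.
  have dt' : (d.-1 <= t)%N by case: (d) dt.
  apply: (flood_informedS gge0 (C := cell c.-1 d.-1)).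
    by apply/fintype.subsetP => i; apply: IH => //; exact: ltnW.
  move=> _; have cT := leq_ltn_trans ct' (ltnW tT); have dT := leq_ltn_trans dt' (ltnW tT).
  apply: lt_le_trans (cells _ _ cT dT) _.
  rewrite mulr_natl -sumr_const; apply: ler_sum => i.
  rewrite finset.inE => /andP[ir /asboolP[/andP[x1' x2'] /andP[y1' y2']]].
  rewrite /node_Eb (negbTE ir) ler_wpM2r ?flood_Eb2_ge0//.
  have /andP[hc1 hc2] := cell_cornerB a c s0; have /andP[hd1 hd2] := cell_cornerB a d s0.
  by apply: (near_gain sr); rewrite ler_norml; apply/andP; split; lra.
rewrite /flood_delivers; apply/setP => j; rewrite finset.in_setT.
have [js|jr] := boolP (is_source j); first exact: inf_src.
have [/andP[x0 xa] /andP[y0 ya]] := box j.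
have [T0 TE] : (0 < flood_slots S)%N /\ (flood_slots S).-1.+1 = flood_slots S.
  by have T0 : (0 < flood_slots S)%N := leq_ltn_trans (leq0n _) aT; rewrite prednK.
have trT (x : R) : x <= a -> (Num.truncn (x / s) <= (flood_slots S).-1)%N.
  move=> hx; rewrite -ltnS TE; apply: leq_ltn_trans aT.
  by apply: le_truncn; rewrite ler_pM2r ?invr_gt0.
rewrite -TE; apply: (informed _ (Num.truncn ((pos j).1 / s)) (Num.truncn ((pos j).2 / s))).
- exact: trT.
- exact: trT.
- by rewrite TE.
- by rewrite finset.inE jr; apply/asboolP; apply: flood_cell_truncn => //; apply/andP.
Qed.

End flood_cells.

(** * Random placements *)

Section uniform_placement.
Context {R : realType}.
Local Notation leb := (@lebesgue_measure R).
Local Notation leb2 := (leb \x leb)%E.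

Lemma leb2_itv (i j : interval R) :
  leb2 ([set` i] `*` [set` j]) = (leb [set` i] * leb [set` j])%E.
Proof. by rewrite product_measure1E//; exact: measurable_itv. Qed.

Lemma measurable_itv2 (i j : interval R) :
  measurable ([set` i] `*` [set` j] : set (measurableTypeR R * measurableTypeR R)).
Proof. by apply: measurableX; exact: measurable_itv. Qed.

Lemma squareE (A : R) : square A = `[0, Num.sqrt A]%classic `*` `[0, Num.sqrt A]%classic.
Proof. by apply/seteqP; split=> p; rewrite /= !in_itv/=. Qed.

Lemma grid_cellE (r0 : R) c d : grid_cell r0 c d =
  `[c%:R * r0, c.+1%:R * r0[%classic `*` `[d%:R * r0, d.+1%:R * r0[%classic.
Proof. by apply/seteqP; split=> p; rewrite /= !in_itv/=. Qed.

Lemma flood_cellE (a s : R) c d : flood_cell a s c d =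
  `[cell_corner a s c, cell_corner a s c + s]%classic `*`
  `[cell_corner a s d, cell_corner a s d + s]%classic.
Proof. by apply/seteqP; split=> p; rewrite /= !in_itv/=. Qed.

Lemma measurable_square (A : R) : measurable (square A : set (measurableTypeR R * measurableTypeR R)).
Proof. by rewrite squareE; exact: measurable_itv2. Qed.

Lemma measurable_grid_cell (r0 : R) c d :
  measurable (grid_cell r0 c d : set (measurableTypeR R * measurableTypeR R)).
Proof. by rewrite grid_cellE; exact: measurable_itv2. Qed.

Lemma measurable_flood_cell (a s : R) c d :
  measurable (flood_cell a s c d : set (measurableTypeR R * measurableTypeR R)).
Proof. by rewrite flood_cellE; exact: measurable_itv2. Qed.

(** Only an inequality, since border cells may stick out of the square; an upper tail needs no
    more. *)
Lemma uniform_grid_cell (A r0 : R) c d : 0 < A -> 0 < r0 ->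
  (uniform_square A (grid_cell r0 c d) <= (r0 ^+ 2 / A)%:E)%E.
Proof.
move=> A0 r00; rewrite /uniform_square [(r0 ^+ 2 / A)%R]mulrC EFinM.
rewrite lee_wpmul2l ?lee_fin ?invr_ge0 ?(ltW A0)//.
apply: (@le_trans _ _ (leb2 (grid_cell r0 c d))).
  apply: le_measure; rewrite ?inE; last by move=> p [].
    by apply: measurableI; [exact: measurable_grid_cell|exact: measurable_square].
  exact: measurable_grid_cell.
rewrite grid_cellE leb2_itv !lebesgue_measure_itv /= !lte_fin.
have lt n : n%:R * r0 < n.+1%:R * r0 by rewrite ltr_pM2r// ltr_nat.
rewrite !lt -!EFinB -EFinM lee_fin -!mulrBl -!natr1; lra.
Qed.

Lemma cell_corner_ge0 (a s : R) c : 0 < s -> s <= a -> 0 <= cell_corner a s c.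
Proof. by move=> s0 sa; rewrite /cell_corner le_min mulr_ge0 ?(ltW s0)// subr_ge0. Qed.

Lemma uniform_flood_cell (A s : R) c d : 0 < A -> 0 < s -> s <= Num.sqrt A ->
  uniform_square A (flood_cell (Num.sqrt A) s c d) = (s ^+ 2 / A)%:E.
Proof.
move=> A0 s0 sa; rewrite /uniform_square [(s ^+ 2 / A)%R]mulrC EFinM; congr (_ * _)%E.
rewrite setIidl; last first.
  move=> p [/andP[h1 h2] /andP[h3 h4]].
  have := cell_corner_ge0 c s0 sa; have := cell_corner_ge0 d s0 sa.
  have : forall e, cell_corner (Num.sqrt A) s e <= Num.sqrt A - s by move=> e; rewrite ge_min lexx orbT.
  move=> h; have := h c; have := h d; move=> *; split; apply/andP; split; lra.
rewrite flood_cellE leb2_itv !lebesgue_measure_itv /= !lte_fin.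
by rewrite !ltrDl s0 -!EFinB -EFinM; congr EFin; ring.
Qed.

Lemma uniform_squareC (A : R) : uniform_square A (~` square A) = 0%E.
Proof. by rewrite /uniform_square setICl measure0 mule0. Qed.

End uniform_placement.

Section bad_placements.
Context {R : realType} {d} {T : measurableType d} (P : probability T R).
Variables (A : nat -> R) (X : forall k, 'I_k -> {RV P >-> (R * R)%type}).
Hypothesis XA : random_placement A X.
Variables (r0 : R) (r0_gt0 : 0 < r0).
Variable k : nat.
Hypotheses (k2 : (2 <= k)%N) (A_lower : r0 ^+ 2 <= 8 * A k).

(* Two adjacent cells of this side fit in a disk of diameter r0. *)
Definition cell_side : R := r0 / Num.sqrt 8.

Lemma cell_side_gt0 : 0 < cell_side.
Proof. by rewrite divr_gt0// sqrtr_gt0. Qed.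

Lemma cell_side_sqr : 8 * cell_side ^+ 2 = r0 ^+ 2.
Proof. by rewrite /cell_side expr_div_n sqr_sqrtr// mulrC divfK. Qed.

Lemma area_gt0 : 0 < A k.
Proof. by have := exprn_gt0 2 r0_gt0; have := A_lower; lra. Qed.

Lemma cell_side_le : cell_side <= Num.sqrt (A k).
Proof.
rewrite -[leLHS](ger0_norm (ltW cell_side_gt0)) -sqrtr_sqr ler_wsqrtr//.
by have := cell_side_sqr; have := A_lower; lra.
Qed.

Definition grid_size : nat := (Num.truncn (Num.sqrt (A k) / r0)).+1.
Definition flood_size : nat := (Num.truncn (Num.sqrt (A k) / cell_side)).+1.
(** The expected number of receivers in a cell of side [r0] inside the square; a cell of side
    [cell_side] expects an eighth of it. *)
Definition density : R := k.-1%:R * r0 ^+ 2 / A k.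

Local Notation receiver := (fun j : 'I_k => ~~ is_source j).
Local Notation pos w := (fun j : 'I_k => X j w).

(** The uniform law confines receivers to the square only almost surely, so this null event is among
    the bad ones. *)
Definition outside : set T := \big[setU/set0]_(j : 'I_k) (X j @^-1` (~` square (A k))).
(** The factor 9/8 is absorbed by [converse_constant]. The factor 3/4 in [deserted] is compensated
    by an excess factor 3/2 in the flooding energy. *)
Definition crowded : set T := \big[setU/set0]_(c : 'I_grid_size * 'I_grid_size)
  [set w | 9 / 8 * density <= #|hits receiver (pos w) (grid_cell r0 c.1 c.2)|%:R].
Definition deserted : set T := \big[setU/set0]_(c : 'I_flood_size * 'I_flood_size)
  [set w | #|hits receiver (pos w) (flood_cell (Num.sqrt (A k)) cell_side c.1 c.2)|%:R
     <= 3 / 4 * (density / 8)].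
Definition bad_placement : set T := outside `|` crowded `|` deserted.

Lemma density_ge0 : 0 <= density.
Proof. by rewrite /density divr_ge0 ?mulr_ge0 ?sqr_ge0// ltW// area_gt0. Qed.

Lemma card_receivers : #|receiver| = k.-1.
Proof.
have k0 : (0 < k)%N by exact: leq_trans k2.
rewrite -[in RHS](card_ord k) -(cardC (pred1 (Ordinal k0))) card1 add1n /=.
by apply: eq_card => j; rewrite !inE /is_source.
Qed.

Lemma prob_cell (j : 'I_k) (B : set (R * R)) : receiver j ->
  measurable (B : set (measurableTypeR R * measurableTypeR R)) ->
  P (X j @^-1` B) = uniform_square (A k) B.
Proof. by move=> jr mB; exact: (placement_uniform XA k2 jr mB). Qed.

Lemma measurable_outside : measurable outside /\ P outside = 0%E.
Proof.
have mS : measurable (~` square (A k) : set (measurableTypeR R * measurableTypeR R)).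
  by apply: measurableC; exact: measurable_square.
have mX (j : 'I_k) : measurable (X j @^-1` (~` square (A k))).
  by have := measurable_funPTI (X j) mS.
have [mO PO] := prob_bigsetU P (index_enum 'I_k) predT mX.
split; first exact: mO.
apply/eqP; rewrite eq_le measure_ge0 andbT; apply: (le_trans PO).
rewrite big1// => j _; have [js|jr] := boolP (is_source j).
  rewrite (_ : _ @^-1` _ = set0) ?measure0//; apply/seteqP; split => // w /=.
  by rewrite (placement_source XA k2 js) /square /= lexx sqrtr_ge0; apply.
by rewrite prob_cell//; exact: uniform_squareC.
Qed.

Lemma tail_cell (B : set (R * R)) (theta mu p : R) (Q : pred nat) :
  measurable (B : set (measurableTypeR R * measurableTypeR R)) ->
  uniform_square (A k) B = p%:E -> 0 < theta ->
  k.-1%:R * p * (theta - 1) <= mu * (theta - 1) ->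
  (forall m, Q m -> theta * mu * ln theta <= m%:R * ln theta) ->
  measurable [set w | Q #|hits receiver (pos w) B|] /\
  (P [set w | Q #|hits receiver (pos w) B|] <= (expR (- (mu * tail_rate theta)))%:E)%E.
Proof.
move=> mB pB th0 pmu Qm.
have j1P : (1 < k)%N by [].
have pE j : receiver j -> P (X j @^-1` B) = p%:E by move=> jr; rewrite prob_cell.
have p01 : 0 <= p <= 1.
  rewrite -!lee_fin -(pE (Ordinal j1P))// measure_ge0 probability_le1//.
  by have := measurable_funPTI (X (Ordinal j1P)) mB.
apply: (tail_hits (placement_indep XA k2) mB pE p01 th0 _ Qm).
by rewrite card_receivers.
Qed.

Lemma tail_grid_cell c e :
  measurable [set w | 9 / 8 * density <= #|hits receiver (pos w) (grid_cell r0 c e)|%:R] /\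
  (P [set w | (9 / 8 * density <= #|hits receiver (pos w) (grid_cell r0 c e)|%:R)%R] <=
    (expR (- (density * tail_rate (9 / 8))))%:E)%E.
Proof.
have le1 := uniform_grid_cell c e area_gt0 r0_gt0.
have pE : uniform_square (A k) (grid_cell r0 c e) = (fine (uniform_square (A k) (grid_cell r0 c e)))%:E.
  rewrite fineK// ge0_fin_numE ?(le_lt_trans le1) ?ltry//.
  by rewrite /uniform_square mule_ge0// lee_fin invr_ge0 ltW// area_gt0.
apply: (tail_cell (Q := fun m => 9 / 8 * density <= m%:R) (measurable_grid_cell r0 c e) pE).
- by [].
- rewrite ler_pM2r; last by lra.
  rewrite /density -mulrA ler_wpM2l ?ler0n//.
  by rewrite -lee_fin -pE.
- by move=> m h; rewrite ler_wpM2r// ln_ge0//; lra.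
Qed.

Lemma tail_flood_cell c e :
  measurable [set w | #|hits receiver (pos w) (flood_cell (Num.sqrt (A k)) cell_side c e)|%:R
     <= 3 / 4 * (density / 8)] /\
  (P [set w | (#|hits receiver (pos w) (flood_cell (Num.sqrt (A k)) cell_side c e)|%:R
     <= 3 / 4 * (density / 8))%R] <= (expR (- (density / 8 * tail_rate (3 / 4))))%R%:E)%E.
Proof.
have pE := uniform_flood_cell c e area_gt0 cell_side_gt0 cell_side_le.
apply: (tail_cell (Q := fun m => m%:R <= 3 / 4 * (density / 8)) (measurable_flood_cell _ _ c e) pE).
- by [].
- have -> : k.-1%:R * (cell_side ^+ 2 / A k) = density / 8 :> R.
    by rewrite /density -cell_side_sqr; field; rewrite gt_eqF// area_gt0.
  by [].
- by move=> m h; rewrite ler_wnM2r// ln_le0//; lra.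
Qed.

(** A common rate for both tails; the division by 8 reflects the smaller mean [density / 8] of
    flooding cells. *)
Definition tail_exponent : R := Num.min (tail_rate (9 / 8)) (tail_rate (3 / 4) / 8).

Lemma prob_bad_placement : measurable bad_placement /\
  (P bad_placement <=
   ((grid_size ^ 2 + flood_size ^ 2)%:R * expR (- (density * tail_exponent)))%:E)%E.
Proof.
have [mO PO] := measurable_outside.
have [mC PC] := prob_bigsetU P (index_enum _) predT
  (fun c : 'I_grid_size * 'I_grid_size => (tail_grid_cell c.1 c.2).1).
have [mD PD] := prob_bigsetU P (index_enum _) predT
  (fun c : 'I_flood_size * 'I_flood_size => (tail_flood_cell c.1 c.2).1).
have dens0 := density_ge0.
split; first by apply: measurableU => //; exact: measurableU.
rewrite natrD mulrDl EFinD /bad_placement.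
have mOC : measurable (outside `|` crowded) by exact: measurableU.
apply: (le_trans (measureU2 P mOC mD)); apply: leeD.
  rewrite -[leRHS]add0e; apply: (le_trans (measureU2 P mO mC)); apply: leeD.
    by rewrite le_eqVlt; apply/orP; left; apply/eqP; exact: PO.
  apply: (le_trans PC).
  apply: (@le_trans _ _ (\sum_(c : 'I_grid_size * 'I_grid_size)
      (expR (- (density * tail_exponent)))%:E)%E).
    apply: lee_sum => c _; apply: (le_trans (tail_grid_cell c.1 c.2).2).
    by rewrite lee_fin ler_expR lerN2 ler_wpM2l// ge_min lexx.
  by rewrite sumEFin sumr_const card_prod card_ord mulr_natl.
apply: (le_trans PD).
apply: (@le_trans _ _ (\sum_(c : 'I_flood_size * 'I_flood_size)
    (expR (- (density * tail_exponent)))%:E)%E).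
  apply: lee_sum => c _; apply: (le_trans (tail_flood_cell c.1 c.2).2).
  have -> : density / 8 * tail_rate (3 / 4) = density * (tail_rate (3 / 4) / 8) :> R by ring.
  by rewrite lee_fin ler_expR lerN2 ler_wpM2l// ge_min lexx orbT.
by rewrite sumEFin sumr_const card_prod card_ord mulr_natl.
Qed.

Lemma not_bad_placement w : ~ bad_placement w ->
  [/\ forall j : 'I_k, square (A k) (X j w),
     forall c d, (c < grid_size)%N -> (d < grid_size)%N ->
       #|hits receiver (pos w) (grid_cell r0 c d)|%:R <= 9 / 8 * density &
     forall c d, (c < flood_size)%N -> (d < flood_size)%N ->
       3 / 4 * (density / 8) <
       #|hits receiver (pos w) (flood_cell (Num.sqrt (A k)) cell_side c d)|%:R].
Proof.
move=> /not_orP[/not_orP[nO nC] nD]; split.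
- move=> j; apply: contrapT => nj; apply: nO.
  by rewrite /outside -bigcup_seq; exists j => //=; rewrite mem_index_enum.
- move=> c e cL dL; apply: contrapT => h; apply: nC.
  rewrite /crowded -bigcup_seq; exists (Ordinal cL, Ordinal dL); first by rewrite /= mem_index_enum.
  by rewrite /=; have [//|/ltW] := leP (9 / 8 * density) _.
- move=> c e cL dL; rewrite ltNge; apply/negP => h; apply: nD.
  by rewrite /deserted -bigcup_seq; exists (Ordinal cL, Ordinal dL); first by rewrite /= mem_index_enum.
Qed.

End bad_placements.

(** * Summable failure probabilities *)

Section asymptotics.
Context {R : realType}.
Variables (A : nat -> R) (r0 : R).
Hypothesis r0_gt0 : 0 < r0.
Hypothesis A_lower : forall k, (2 <= k)%N -> r0 ^+ 2 <= 8 * A k.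
Hypothesis A_upper : A =o_\oo (fun k => k%:R / ln k%:R : R).

(** Since [s <= a] and [s <= r0], each system has at most [2 * (a / s)] cells per side, hence at
    most [32 / r0 ^+ 2 * A k] cells. *)
Lemma sqr_sizes_le k : (2 <= k)%N ->
  (grid_size A r0 k ^ 2 + flood_size A r0 k ^ 2)%:R <= 64 / r0 ^+ 2 * A k.
Proof.
move=> k2; have s0 := cell_side_gt0 r0_gt0; have ss := cell_side_sqr r0.
have A0 := area_gt0 r0_gt0 (A_lower k2).
have sa := cell_side_le r0_gt0 (A_lower k2).
set a := Num.sqrt (A k) in sa *; set s := cell_side r0 in s0 ss sa *.
have aA : a ^+ 2 = A k by rewrite sqr_sqrtr// ltW.
have a0 : 0 < a by exact: lt_le_trans sa.
have sr : s <= r0.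
  rewrite -[leRHS](ger0_norm (ltW r0_gt0)) -[leLHS](ger0_norm (ltW s0)) -!sqrtr_sqr ler_wsqrtr// -ss.
  by have := sqr_ge0 s; lra.
have key (r : R) : s <= r -> (Num.truncn (a / r)).+1%:R <= 2 * (a / s).
  move=> hr; have r_gt0 : 0 < r by exact: lt_le_trans hr.
  have h1 : (Num.truncn (a / r))%:R <= a / r by rewrite truncn_le divr_ge0// ltW.
  have h2 : a / r <= a / s by rewrite ler_wpM2l ?(ltW a0)// lef_pV2.
  have h3 : 1 <= a / s by rewrite ler_pdivlMr// mul1r.
  by rewrite -natr1; lra.
have sq (r : R) : s <= r -> ((Num.truncn (a / r)).+1 ^ 2)%:R <= 32 / r0 ^+ 2 * A k.
  move=> /key h; rewrite natrX.
  have -> : 32 / r0 ^+ 2 * A k = (2 * (a / s)) ^+ 2.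
    by rewrite -ss -aA; field; rewrite gt_eqF.
  by rewrite lerXn2r// nnegrE ?ler0n// (le_trans _ h).
have := sq _ sr; have := sq _ (lexx s); rewrite natrD /grid_size /flood_size -/a -/s.
lra.
Qed.

Lemma tail_exponent_gt0 : 0 < tail_exponent :> R.
Proof.
rewrite /tail_exponent lt_min divr_gt0 ?tail_rate_gt0//; apply/negP => /eqP; lra.
Qed.

(** [A k = o(k / ln k)] makes the exponent at least [3 * ln k], so each cell fails with probability
    at most [k ^ -3]; there are [O(A k)], hence [O(k)], cells. *)
Lemma prob_bad_le : exists2 C : R, 0 <= C & \forall k \near \oo, (2 <= k)%N ->
  (grid_size A r0 k ^ 2 + flood_size A r0 k ^ 2)%:R *
    expR (- (density A r0 k * tail_exponent)) <= C * k%:R `^ (- (1 + 1)).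
Proof.
have te := tail_exponent_gt0; set tau := tail_exponent in te *.
have r2 : 0 < r0 ^+ 2 by rewrite exprn_gt0.
have ln2 : 0 < ln 2 :> R by rewrite ln_gt0// ltr1n.
(* The 6 is 3, for the exponent [3 * ln k], times 2, from [k <= 2 * (k - 1)]. *)
pose e := tau * r0 ^+ 2 / 6.
have e0 : 0 < e by rewrite divr_gt0// mulr_gt0.
exists (64 / r0 ^+ 2 * (e / ln 2)).
  by rewrite mulr_ge0// divr_ge0// ltW.
move/eqoP: A_upper => /(_ e e0); apply: filter_app.
near=> k => Ak k2.
have k0 : 0 < k%:R :> R by rewrite ltr0n; exact: leq_trans k2.
have lnk2 : ln 2 <= ln k%:R :> R by rewrite ler_ln ?posrE// ler_nat.
have lnk : 0 < ln k%:R :> R by exact: lt_le_trans lnk2.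
have A0 := area_gt0 r0_gt0 (A_lower k2).
move: Ak; rewrite [`|A k|]ger0_norm ?(ltW A0)// ger0_norm; last by rewrite divr_ge0// ltW.
rewrite mulrA ler_pdivlMr// => Ak.
have dens : 3 * ln k%:R <= density A r0 k * tau.
  rewrite /density mulrAC ler_pdivlMr//.
  have k1 : k%:R <= 2 * k.-1%:R :> R by rewrite -natrM ler_nat; lia.
  apply: (@le_trans _ _ (3 * (e * k%:R))); first by lra.
  apply: (@le_trans _ _ (3 * (e * (2 * k.-1%:R)))).
    by rewrite !ler_pM2l.
  by rewrite /e; lra.
have exple : expR (- (density A r0 k * tau)) <= k%:R `^ (- 3).
  by rewrite /powR gt_eqF// ler_expR mulNr lerN2.
apply: (@le_trans _ _ (64 / r0 ^+ 2 * A k * k%:R `^ (- 3))).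
  by apply: ler_pM => //; rewrite ?expR_ge0 ?sqr_sizes_le.
have -> : k%:R `^ (- (1 + 1)) = k%:R * k%:R `^ (- 3) :> R.
  rewrite -[X in _ = X * _]powRr1 ?(ltW k0)// -powRD; last by rewrite (gt_eqF k0) implybT.
  by congr (_ `^ _); ring.
rewrite [leRHS]mulrA ler_wpM2r ?powR_ge0// -[leRHS]mulrA; apply: ler_wpM2l.
  by rewrite divr_ge0// ltW.
rewrite mulrAC ler_pdivlMr//; apply: le_trans Ak.
by rewrite ler_wpM2l// ltW.
Unshelve. all: by end_near. Qed.

End asymptotics.

Section borel_cantelli.
Context {R : realType} {d} {T : measurableType d} (P : probability T R).

(** The exponent is written [- (1 + 1)] to match [sum_powR_le] with [beta = 1], which bounds the sum
    from index 1 by 2; index 0 is kept apart. *)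
Lemma borel_cantelli_sqr (F : nat -> set T) (C : R) :
  (forall k, measurable (F k)) ->
  (forall k, (P (F k) <= (C * k%:R `^ (- (1 + 1)))%:E)%E) ->
  P (lim_sup_set F) = 0%E.
Proof.
move=> mF PF; apply: lim_sup_set_cvg0 => //.
apply: (@le_lt_trans _ _ (P (F 0%N) + (`|C| * 2)%:E)%E); last first.
  by rewrite lte_add_pinfty ?ltry// (le_lt_trans (probability_le1 P _)) ?ltry.
apply: lime_le; first by apply: is_cvg_nneseries => *; exact: measure_ge0.
near=> n.
rewrite big_ltn; last by near: n; exact: nbhs_infty_gt.
apply: leeD2l; apply: (@le_trans _ _ (\sum_(1 <= k < n) (`|C| * k%:R `^ (- (1 + 1)))%:E)%E).
  apply: lee_sum => k _; apply: (le_trans (PF k)).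
  by rewrite lee_fin ler_wpM2r ?powR_ge0// ler_norm.
rewrite sumEFin -mulr_sumr lee_fin ler_wpM2l//.
by have := @sum_powR_le R 1 n ltr01; rewrite invr1.
Unshelve. all: by end_near. Qed.

End borel_cantelli.

(** * Numerical constants *)

Section constants.
Context {R : realType}.

(** From [ln 2 >= 1 / 2] one gets [2 ^ x >= 1 + x / 2]. This is applied after extracting a factor 4
    if [alpha <= 3], and 8 otherwise. *)
Lemma le_18_powR2 (alpha : R) : 2 < alpha -> 18 * (alpha - 1) <= 6 * 2 `^ alpha.
Proof.
move=> a2.
have ln2 : 1 / 2 <= ln 2 :> R.
  have h : 0 < 2^-1 :> R by rewrite invr_gt0.
  by have := ln_leB1 h; rewrite lnV ?posrE//; lra.
have lin (x : R) : 0 <= x -> 1 + x / 2 <= 2 `^ x.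
  move=> x0; rewrite /powR pnatr_eq0 /=; apply: le_trans (expR_ge1Dx _).
  by rewrite lerD2l; have := ler_wpM2l x0 ln2; lra.
have -> : 2 `^ alpha = 4 * 2 `^ (alpha - 2) :> R.
  have -> : (4 : R) = 2 `^ 2 by rewrite (powR_mulrn 2)//; ring.
  rewrite -powRD ?pnatr_eq0 ?implybT//; congr (_ `^ _); ring.
have [x1|x1] := leP (alpha - 2) 1.
  by have := lin (alpha - 2); rewrite subr_ge0 => /(_ (ltW a2)); lra.
have -> : 2 `^ (alpha - 2) = 2 * 2 `^ (alpha - 3) :> R.
  rewrite -[X in _ = X * _](powRr1 (a := 2))// -powRD ?pnatr_eq0 ?implybT//.
  by congr (_ `^ _); ring.
by have := lin (alpha - 3); rewrite subr_ge0 => /(_ _); lra.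
Qed.

(** The denominator of [c1] is at least twice the one on the right: 49 exceeds [81 / 4], and
    [12 * 2 ^ alpha] exceeds [36 * (alpha - 1)] by [le_18_powR2]. *)
Lemma converse_constant (alpha r0 gbar : R) : 2 < alpha -> 0 < r0 -> 0 < gbar ->
  2 * ln 2 / (49 * gbar * r0 ^+ 2 +
     2 `^ (alpha + 2) / (alpha - 2) * (3 / r0 `^ (alpha - 2))) <=
  ln 2 / (9 / 8 * r0 ^+ 2 * gain_bound alpha r0 gbar).
Proof.
move=> a2 r00 gb0; have ln20 : 0 < ln 2 :> R by rewrite ln_gt0// ltr1n.
have r2 : 0 < r0 ^+ 2 by rewrite exprn_gt0.
have rb : 0 < r0 `^ (- (alpha - 2)) by rewrite powR_gt0.
set rho := r0 `^ (- (alpha - 2)) in rb.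
have rE : r0 ^+ 2 * r0 `^ (- alpha) = rho.
  rewrite -[r0 ^+ 2](powR_mulrn 2 (ltW r00)) -powRD ?(gt_eqF r00) ?implybT//.
  by rewrite /rho; congr (_ `^ _); ring.
have rV : 3 / r0 `^ (alpha - 2) = 3 * rho by rewrite /rho powRN.
have pE : 2 `^ (alpha + 2) = 4 * 2 `^ alpha :> R.
  have -> : (4 : R) = 2 `^ 2 by rewrite (powR_mulrn 2)//; ring.
  rewrite -powRD ?pnatr_eq0 ?implybT//; congr (_ `^ _); ring.
have a20 : 0 < alpha - 2 by rewrite subr_gt0.
pose u := rho / (alpha - 2); have u0 : 0 < u by rewrite divr_gt0.
have gr : 0 < gbar * r0 ^+ 2 by rewrite mulr_gt0.
have dE : 9 / 8 * r0 ^+ 2 * gain_bound alpha r0 gbar =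
    81 / 8 * (gbar * r0 ^+ 2) + (alpha - 1) * (18 * u).
  rewrite /gain_bound mulrDr; congr (_ + _); first ring.
  by rewrite /u -rE; field; rewrite gt_eqF.
have DE : 49 * gbar * r0 ^+ 2 + 2 `^ (alpha + 2) / (alpha - 2) * (3 / r0 `^ (alpha - 2)) =
    49 * (gbar * r0 ^+ 2) + 12 * 2 `^ alpha * u.
  by rewrite rV pE /u; field; rewrite gt_eqF.
rewrite {}dE {}DE; clearbody u.
have d0 : 0 < 81 / 8 * (gbar * r0 ^+ 2) + (alpha - 1) * (18 * u).
  have a10 : 0 < alpha - 1 by lra.
  by rewrite addr_gt0 ?mulr_gt0.
have := ler_wpM2r (ltW u0) (le_18_powR2 a2) => h.
have le : 2 * (81 / 8 * (gbar * r0 ^+ 2) + (alpha - 1) * (18 * u)) <=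
    49 * (gbar * r0 ^+ 2) + 12 * 2 `^ alpha * u by lra.
have D0 : 0 < 49 * (gbar * r0 ^+ 2) + 12 * 2 `^ alpha * u by apply: lt_le_trans le; lra.
rewrite ler_pdivrMr// mulrAC ler_pdivlMr//.
by have := ler_wpM2l (ltW ln20) le; lra.
Qed.

End constants.

(** * Energy bounds on a good placement *)

Section good_placements.
Context {R : realType} (alpha r0 gbar N0 : R) (g : R -> R) (A : nat -> R).
Hypotheses (alpha_gt2 : 2 < alpha) (r0_gt0 : 0 < r0) (gbar_gt0 : 0 < gbar)
  (N0_gt0 : 0 < N0) (g_loss : path_loss alpha r0 gbar g).
Variables (k : nat).
Hypotheses (k2 : (2 <= k)%N) (A_lower : r0 ^+ 2 <= 8 * A k).
Variable pos : 'I_k -> R * R.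
Hypotheses (pos_square : forall j, square (A k) (pos j))
  (pos_source : forall j, is_source j -> pos j = (0, 0)).

Local Notation receiver := (fun j : 'I_k => ~~ is_source j).
Local Notation gain := (path_gain g pos).
Local Notation dens := (density A r0 k).

Let A0 : 0 < A k. Proof. exact: (area_gt0 r0_gt0 A_lower). Qed.

Let k1 : 0 < k.-1%:R :> R. Proof. by rewrite ltr0n -ltnS prednK// ltnW. Qed.

Let ln20 : 0 < ln 2 :> R. Proof. by rewrite ln_gt0// ltr1n. Qed.

Lemma Eb_min_of_counts (d : measure_display) (T : measurableType d)
    (P : probability T R) (ch : channel k P) :
  channel_model ch N0 gain ->
  (forall c e, (c < grid_size A r0 k)%N -> (e < grid_size A r0 k)%N ->
     #|hits receiver pos (grid_cell r0 c e)|%:R <= 9 / 8 * dens) ->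
  ((2 * ln 2 / (49 * gbar * r0 ^+ 2 +
     2 `^ (alpha + 2) / (alpha - 2) * (3 / r0 `^ (alpha - 2))))%:E <=
   (A k)^-1%:E * (Eb_min ch * N0^-1%:E))%E.
Proof.
move=> model counts.
have dens0 : 0 < dens by rewrite divr_gt0// mulr_gt0// exprn_gt0.
have gb0 : 0 < gain_bound alpha r0 gbar.
  have a10 : 0 < alpha - 1 by rewrite subr_gt0 (lt_trans _ alpha_gt2)// ltr1n.
  have a20 : 0 < alpha - 2 by rewrite subr_gt0.
  have ra0 : 0 < r0 `^ (- alpha) by rewrite powR_gt0.
  by rewrite addr_gt0 ?mulr_gt0 ?invr_gt0.
have G0 : 0 < 9 / 8 * dens * gain_bound alpha r0 gbar.
  by rewrite mulr_gt0// mulr_gt0// divr_gt0.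
have sumG := gain_sum_le alpha_gt2 r0_gt0 g_loss pos_square (ltnSn _) counts.
have := Eb_min_lower_bound N0_gt0 model G0 sumG.
rewrite (card_receivers k2) => h.
apply: (@le_trans _ _ ((A k)^-1%:E *
    ((ln 2 * N0 * k.-1%:R / (9 / 8 * dens * gain_bound alpha r0 gbar))%:E * N0^-1%:E))%E).
  rewrite -!EFinM lee_fin; apply: le_trans (converse_constant alpha_gt2 r0_gt0 gbar_gt0) _.
  rewrite le_eqVlt; apply/orP; left; apply/eqP; rewrite /density.
  by field; rewrite ?gt_eqF// ?exprn_gt0.
rewrite lee_wpmul2l ?lee_fin ?invr_ge0 ?(ltW A0)//.
by rewrite lee_wpmul2r ?lee_fin ?invr_ge0 ?(ltW N0_gt0).
Qed.

(** Both energies exceed by a factor 3/2 what would suffice with mean counts; hence 12 is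
    [8 * 3 / 2], and counts above 3/4 of the mean still leave [9 / 8 > 1]. In [c2], receivers
    contribute 12, and the source at most [3 / 2 * 8] because [r0 ^+ 2 / A k <= 8]. *)
Lemma flood_of_counts (S : flood_scheme R) :
  flood_Eb1 S = 3 / 2 * (N0 * ln 2) * r0 `^ alpha ->
  flood_Eb2 S = 12 * (N0 * ln 2) * (A k / k.-1%:R) * r0 `^ (alpha - 2) ->
  flood_slots S = flood_size A r0 k ->
  (forall c e, (c < flood_size A r0 k)%N -> (e < flood_size A r0 k)%N ->
     3 / 4 * (dens / 8) <
     #|hits receiver pos (flood_cell (Num.sqrt (A k)) (cell_side r0) c e)|%:R) ->
  flood_delivers N0 gain S /\
  (A k)^-1 * (flood_total_Eb N0 gain S / N0) <= 24 * r0 `^ (alpha - 2) * ln 2.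
Proof.
move=> S1 S2 ST counts.
have NL : 0 < N0 * ln 2 by rewrite mulr_gt0.
have ra : r0 `^ (- alpha) * r0 `^ alpha = 1.
  by rewrite powRN mulVf// gt_eqF// powR_gt0.
have k0 : (0 < k)%N by exact: ltnW.
have r2 : 0 < r0 ^+ 2 by rewrite exprn_gt0.
have rE : r0 `^ alpha = r0 ^+ 2 * r0 `^ (alpha - 2).
  rewrite -[r0 ^+ 2](powR_mulrn 2 (ltW r0_gt0)) -powRD ?(gt_eqF r0_gt0) ?implybT//.
  by congr (_ `^ _); ring.
split.
  apply: (flood_cells_deliver r0_gt0 g_loss (cell_side_gt0 r0_gt0) (cell_side_sqr r0)
    (cell_side_le r0_gt0 A_lower) pos_source _ pos_square).
  - by exists (Ordinal k0).
  - by rewrite ST.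
  - rewrite S1 mulrCA ra mulr1; lra.
  - move=> c e; rewrite ST => cT eT; have {}counts := counts _ _ cT eT.
    have E2 : r0 `^ (- alpha) * flood_Eb2 S = 12 * (N0 * ln 2) * (A k / k.-1%:R) / r0 ^+ 2.
      have ra' : r0 `^ (- alpha) * r0 `^ (alpha - 2) = (r0 ^+ 2)^-1.
        by apply: (mulfI (x := r0 ^+ 2)); rewrite ?gt_eqF// mulrCA -rE ra divff// gt_eqF.
      by rewrite S2 mulrCA ra'.
    have E20 : 0 < r0 `^ (- alpha) * flood_Eb2 S.
      by rewrite E2 !mulr_gt0 ?invr_gt0.
    move: counts; rewrite -(ltr_pM2r E20) => /(le_lt_trans _); apply.
    have -> : 3 / 4 * (dens / 8) * (r0 `^ (- alpha) * flood_Eb2 S) = 9 / 8 * (N0 * ln 2).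
      by rewrite E2 /density; field; rewrite ?gt_eqF.
    lra.
have tot : flood_total_Eb N0 gain S <= flood_Eb1 S + k.-1%:R * flood_Eb2 S.
  apply: le_trans (flood_total_Eb_le _ _ _) _.
  rewrite (bigID (@is_source k)) /= lerD//.
    rewrite (big_pred1 (Ordinal k0)) ?/node_Eb//=.
  rewrite (eq_bigr (fun=> flood_Eb2 S)); last by move=> i /negbTE; rewrite /node_Eb => ->.
  by rewrite sumr_const (card_receivers k2) mulr_natl.
apply: (@le_trans _ _ ((A k)^-1 * ((flood_Eb1 S + k.-1%:R * flood_Eb2 S) / N0))).
  by rewrite ler_wpM2l ?invr_ge0 ?(ltW A0)// ler_wpM2r ?invr_ge0 ?(ltW N0_gt0).
have rb : 0 < r0 `^ (alpha - 2) by rewrite powR_gt0.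
have -> : (A k)^-1 * ((flood_Eb1 S + k.-1%:R * flood_Eb2 S) / N0) =
    (3 / 2 * (r0 ^+ 2 / A k) + 12) * (r0 `^ (alpha - 2) * ln 2).
  by rewrite S1 S2 rE; field; rewrite !gt_eqF.
rewrite -[leRHS]mulrA ler_wpM2r ?mulr_ge0 ?(ltW rb) ?(ltW ln20)//.
have : r0 ^+ 2 / A k <= 8 by rewrite ler_pdivrMr.
lra.
Qed.

End good_placements.

Lemma Eb_flood_cst {R : realType} {k : nat} (N0 : R) (gain : 'I_k -> 'I_k -> R)
    (S : flood_scheme R) : Eb_flood N0 gain (fun=> S) = flood_total_Eb N0 gain S.
Proof.
rewrite /Eb_flood (_ : range _ = [set flood_total_Eb N0 gain S]) ?inf1//.
by apply/seteqP; split=> [_ [_ _ <-]//|_ ->]; exists 0%N.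
Qed.

Theorem theorem2 (R : realType) (alpha r0 gbar N0 : R) (g : R -> R)
    (A : nat -> R)
    (alpha_gt2 : 2 < alpha) (r0_gt0 : 0 < r0) (gbar_gt0 : 0 < gbar)
    (N0_gt0 : 0 < N0)
    (g_path_loss : path_loss alpha r0 gbar g)
    (A_lower : forall k, (2 <= k)%N -> r0 ^+ 2 <= 8 * A k)
    (A_upper : A =o_\oo (fun k => k%:R / ln k%:R : R)) :
  let c1 : R := 2 * ln 2 /
    (49 * gbar * r0 ^+ 2 +
     2 `^ (alpha + 2) / (alpha - 2) * (3 / r0 `^ (alpha - 2))) in
  let c2 : R := 24 * r0 `^ (alpha - 2) * ln 2 in
  exists S : nat -> nat -> flood_scheme R,
  forall (d : measure_display) (T : measurableType d) (P : probability T R)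
    (X : forall k, 'I_k -> {RV P >-> (R * R)%type}),
  random_placement A X ->
  {ae P, forall w, \forall k \near \oo,
    let gain := path_gain g (fun i => X k i w) in
    (forall (d' : measure_display) (T' : measurableType d')
       (P' : probability T' R) (ch : channel k P'),
       channel_model ch N0 gain ->
       (c1%:E <= (A k)^-1%:E * (Eb_min ch * N0^-1%:E))%E) /\
    (forall s, flood_delivers N0 gain (S k s)) /\
    (A k)^-1 * (Eb_flood N0 gain (S k) / N0) <= c2}.
Proof.
move=> c1 c2.
have ln20 : 0 < ln 2 :> R by rewrite ln_gt0// ltr1n.
have Eb1_ge0 : 0 <= 3 / 2 * (N0 * ln 2) * r0 `^ alpha.
  by rewrite !mulr_ge0 ?powR_ge0 ?(ltW N0_gt0) ?(ltW ln20).
(* A k may be negative for k < 2, hence the absolute value. *)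
have Eb2_ge0 k : 0 <= 12 * (N0 * ln 2) * (`|A k| / k.-1%:R) * r0 `^ (alpha - 2).
  by rewrite !mulr_ge0 ?powR_ge0 ?(ltW N0_gt0) ?(ltW ln20) ?invr_ge0.
exists (fun k _ => FloodScheme (flood_size A r0 k) Eb1_ge0 (Eb2_ge0 k)).
move=> d T P X XA.
have [C C0 [K1 _ badC]] := prob_bad_le r0_gt0 A_lower A_upper.
pose K := maxn K1 2.
(* The bound holds only from some index on; emptying the earlier events leaves the limit superior
   unchanged. *)
pose F k := if (k < K)%N then set0 else bad_placement A X r0 k.
have F_bad k : (K <= k)%N -> [/\ d.-measurable (F k), F k = bad_placement A X r0 k &
    (P (F k) <= (C * k%:R `^ (- (1 + 1)))%:E)%E].
  rewrite /F ltnNge => Kk; rewrite Kk /=.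
  have /andP[K1k k2] : (K1 <= k)%N && (2 <= k)%N by rewrite -geq_max.
  have [mbad Pbad] := prob_bad_placement XA r0_gt0 k2 (A_lower _ k2).
  by split=> //; apply: le_trans Pbad _; rewrite lee_fin; exact: badC.
have F_le k : (P (F k) <= (C * k%:R `^ (- (1 + 1)))%:E)%E.
  have [/F_bad[]//|kK] := leqP K k.
  by rewrite /F kK measure0 lee_fin mulr_ge0 ?powR_ge0.
have mF k : d.-measurable (F k).
  by have [/F_bad[]//|kK] := leqP K k; rewrite /F kK.
have mlimF : d.-measurable (lim_sup_set F).
  by apply: bigcap_measurable => // n _; apply: bigcup_measurable => j _; exact: mF.
(* The exceptional set depends on the placements only, so it serves all channels at once. *)
exists (lim_sup_set F); split=> //; first exact: borel_cantelli_sqr mF F_le.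
move=> w /= not_good; apply: contrapT => wF; apply: not_good.
have [n nF] : exists n, forall k, (n <= k)%N -> ~ F k w.
  apply: contrapT => none; apply: wF => n _; apply: contrapT => nF.
  by apply: none; exists n => k nk Fk; apply: nF; exists k.
exists (maxn n K) => // k /=; rewrite geq_max => /andP[nk Kk].
have k2 : (2 <= k)%N by apply: leq_trans Kk; rewrite leq_maxr.
have [_ FE _] := F_bad _ Kk.
have := nF _ nk; rewrite FE => /not_bad_placement[sq crowd desert].
have src j : is_source j -> X k j w = (0, 0) by move=> /(placement_source XA k2).
have A0 : 0 <= A k := ltW (area_gt0 r0_gt0 (A_lower _ k2)).
split=> [d' T' P' ch model|].
  exact: (Eb_min_of_counts alpha_gt2 r0_gt0 gbar_gt0 N0_gt0 g_path_loss k2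
    (A_lower _ k2) sq model crowd).
pose S := FloodScheme (flood_size A r0 k) Eb1_ge0 (Eb2_ge0 k).
have S2 : flood_Eb2 S = 12 * (N0 * ln 2) * (A k / k.-1%:R) * r0 `^ (alpha - 2).
  by rewrite /= ger0_norm.
have [deliver total] := flood_of_counts r0_gt0 N0_gt0 g_path_loss k2
  (A_lower _ k2) sq src (S := S) erefl S2 erefl desert.
by split=> //; rewrite Eb_flood_cst.
Qed.
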